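(* Let $k\ge1$ and let $\Gamma\le S_k$ be an arbitrary subgroup. For $n\ge1$ let $\sigma$ be uniform in $\Gamma^n\rtimes S_n$, let $C_1,C_2,\dots$ be its cycle lengths and $O_n=\operatorname{lcm}\{C_1,C_2,\dots\}$. Then, for fixed $k$ and $\Gamma$, $$\frac{\log O_n-\frac12\log^2 n}{\sqrt{\frac13\log^3 n}}\xrightarrow{d} N(0,1)\quad(n\to\infty).$$ If $\Gamma=C_k$ is the cyclic subgroup generated by a $k$-cycle, the same convergence holds when $k=k(n)$ varies with $n$ subject to $\log k=o(\log^{3/2}n)$.
   Context: $\Gamma^n\rtimes S_n$ is the set of permutations $\sigma=(g_1,\dots,g_n;h)$ of $\{1,\dots,kn\}$ with $g_i\in\Gamma$, $h\in S_n$, acting by $(i-1)k+r\mapsto (h(i)-1)k+g_i(r)$ for $1\le i\le n$, $1\le r\le k$. *)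

(* Defs.v *)
From Stdlib Require Import Reals.
From Coquelicot Require Import Coquelicot.
From mathcomp Require Import all_boot all_fingroup.

Set Implicit Arguments.
Unset Strict Implicit.
Unset Printing Implicit Defensive.
Open Scope nat_scope.

(* The action of (g_1,..,g_n; h) in Gamma^n x| S_n on {0,..,kn-1}
   (0-based version of {1,..,kn}):  i*k + r  |->  h(i)*k + g_i(r). *)

Lemma wr_k_pos k n (x : 'I_(k * n)) : 0 < k.
Proof. case: k x => [|k] [x] //=; by rewrite mul0n. Qed.

Lemma wr_div_lt k n (x : 'I_(k * n)) : x %/ k < n.
Proof. have := ltn_ord x; by rewrite ltn_divLR ?(wr_k_pos x) // [_ * k]mulnC. Qed.

Lemma wr_mod_lt k n (x : 'I_(k * n)) : x %% k < k.
Proof. by rewrite ltn_mod (wr_k_pos x). Qed.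

Definition wr_blk k n (x : 'I_(k * n)) : 'I_n := Ordinal (wr_div_lt x).
Definition wr_pos k n (x : 'I_(k * n)) : 'I_k := Ordinal (wr_mod_lt x).

Lemma wr_img_lt k n (i : 'I_n) (r : 'I_k) : i * k + r < k * n.
Proof.
have lt1 : i * k + r < i.+1 * k by rewrite mulSn addnC ltn_add2r.
apply: leq_trans lt1 _; rewrite mulnC leq_mul2l ltn_ord orbT //.
Qed.

Definition wr_fun k n (g : {ffun 'I_n -> {perm 'I_k}}) (h : {perm 'I_n})
  (x : 'I_(k * n)) : 'I_(k * n) :=
  Ordinal (wr_img_lt (h (wr_blk x)) (g (wr_blk x) (wr_pos x))).

Lemma wr_fun_inj k n g h : injective (@wr_fun k n g h).
Proof.
move=> x y /(congr1 val) /= E.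
have kp := wr_k_pos x.
have Ed : (h (wr_blk x) * k + g (wr_blk x) (wr_pos x)) %/ k
        = (h (wr_blk y) * k + g (wr_blk y) (wr_pos y)) %/ k by rewrite E.
rewrite !divnMDl // !divn_small ?ltn_ord // !addn0 in Ed.
have Eb : wr_blk x = wr_blk y by apply: (perm_inj (s := h)); apply: val_inj.
rewrite Eb in E; move/eqP: E; rewrite eqn_add2l => /eqP E.
have Ep : wr_pos x = wr_pos y by apply: (perm_inj (s := g (wr_blk y))); apply: val_inj.
apply: val_inj => /=; rewrite (divn_eq x k) (divn_eq y k).
by move: (congr1 val Eb) (congr1 val Ep) => /= -> ->.
Qed.

Definition wr_perm k n (p : {ffun 'I_n -> {perm 'I_k}} * {perm 'I_n})
  : {perm 'I_(k * n)} := perm (@wr_fun_inj k n p.1 p.2).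

Definition wreath k n (Gamma : {set {perm 'I_k}})
  : {set {ffun 'I_n -> {perm 'I_k}} * {perm 'I_n}} :=
  [set p : {ffun 'I_n -> {perm 'I_k}} * {perm 'I_n} | [forall i, p.1 i \in Gamma]].

Definition lcm_cycles (T : finType) (s : {perm T}) : nat :=
  \big[lcmn/1%N]_(C in porbits s) #|C|.

Open Scope R_scope.

Definition Rleb (a b : R) : bool := if Rle_dec a b then true else false.

Definition normalized_log_order k n
  (p : {ffun 'I_n -> {perm 'I_k}} * {perm 'I_n}) : R :=
  (ln (INR (lcm_cycles (wr_perm p))) - / 2 * (ln (INR n)) ^ 2)
  / sqrt (/ 3 * (ln (INR n)) ^ 3).

Definition cdf_wr k n (Gamma : {set {perm 'I_k}}) (x : R) : R :=
  INR #|[set p in wreath n Gamma | Rleb (normalized_log_order p) x]|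
  / INR #|wreath n Gamma|.

Definition Phi (x : R) : R :=
  / sqrt (2 * PI) *
  RInt_gen (fun t => exp (- (t ^ 2) / 2)) (Rbar_locally m_infty) (at_point x).

(* convergence in distribution to N(0,1): pointwise convergence of CDFs
   (N(0,1) has a continuous CDF, so every x is a continuity point) *)
Definition conv_to_std_normal (F : nat -> R -> R) : Prop :=
  forall x : R, is_lim_seq (fun n => F n x) (Phi x).

Definition is_full_cycle k (c : {perm 'I_k}) : Prop :=
  forall i : 'I_k, porbit c i = [set: 'I_k].

(* Main.v *)
Require Import Defs.
From HB Require Import structures.
From Stdlib Require Import Reals Lra.
From Coquelicot Require Import Coquelicot.
From mathcomp Require Import all_boot all_fingroup cyclic.

(* The order of (g_1, .., g_n; h) is a multiple of the order of h and divides it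
   times |Gamma|, so its logarithm differs from log (order h) by at most
   log |Gamma| = o (log^{3/2} n): everything reduces to a uniform h in S_n with
   cycle lengths l_1, l_2, ..

   For such h, sum_i log l_i - log lcm (l_i) is at most the sum over prime powers
   q of log q * (D_q - 1)^+, where D_q counts the l_i divisible by q.  As
   E D_q <= H_n / q and E D_q (D_q - 1) <= 2 (H_n / q)^2, its mean is
   O (log^{5/4} n) = o (log^{3/2} n).

   The cycle containing a given point has uniform length on {1, .., n} and leaves
   a uniform permutation of the other points.  Replacing log l by log n in this
   recursion costs O (1) per cycle, hence O (log n) in all, and turns sum_i log l_i
   into log n + sum_j xi_j log j with independent xi_j, P (xi_j = 1) = 1 / (j + 1).
   Lindeberg's argument along the heat flow v |-> Phi ((c - x) / sqrt v) gives
   the limit of the mean of the smoothed indicator Phi ((c - X_n) / sqrt v), and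
   letting v tend to 0 gives the convergence of the distribution functions. *)

Set Implicit Arguments.
Unset Strict Implicit.
Unset Printing Implicit Defensive.

(** * Means over cycle types *)

(** The exponent 5/4 is an interpolation: with a = H_n / q the two moments give E (D_q - 1)^+ <= min
    (a, a^2) <= a^e for 1 <= e <= 2. Convergence of the sum of log q / q^e asks for e > 1, smallness
    against log^{3/2} n for e < 3/2; with such an e nothing about the density of primes is needed.
    The independent xi_j appear because, once each log l is replaced by the log of the number of
    points left, only the chain jumping from j to a uniform state below j matters. From any larger
    start it visits the states j independently, with probability 1 / (j + 1). The functions Phi ((c
    - x) / sqrt v) are stable under Gaussian averaging, which only moves c and v. Lindeberg's
    comparison therefore involves no Gaussian expectation, only the parameters at which Phi is
    evaluated. Scaled jumps have size O (log^{-1/2} n) and there are O (log n) of them on average,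
    so the third-order error is O (log^{-1/2} n). *)

HB.instance Definition _ :=
  Monoid.isComLaw.Build R R0 Rplus
    (fun x y z => esym (Rplus_assoc x y z)) Rplus_comm Rplus_0_l.

Notation "\rsum_ ( i <- r | P ) F" := (\big[Rplus/R0]_(i <- r | P%B) F)
  (at level 34, F at level 41, i, r at level 60).
Notation "\rsum_ ( i <- r ) F" := (\big[Rplus/R0]_(i <- r) F)
  (at level 34, F at level 41, i, r at level 60).
Notation "\rsum_ ( i : t | P ) F" := (\big[Rplus/R0]_(i : t | P%B) F)
  (at level 34, F at level 41, i at level 60).
Notation "\rsum_ ( i : t ) F" := (\big[Rplus/R0]_(i : t) F)
  (at level 34, F at level 41, i at level 60).
Notation "\rsum_ ( i < n ) F" := (\big[Rplus/R0]_(i < n) F)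
  (at level 34, F at level 41, i, n at level 60).
Notation "\rsum_ ( m <= i < n ) F" := (\big[Rplus/R0]_(m <= i < n) F)
  (at level 34, F at level 41, i, m, n at level 60).
Notation "\rsum_ ( m <= i < n | P ) F" := (\big[Rplus/R0]_(m <= i < n | P%B) F)
  (at level 34, F at level 41, i, m, n at level 60).
Notation "\rsum_ ( i 'in' A ) F" := (\big[Rplus/R0]_(i in A) F)
  (at level 34, F at level 41, i, A at level 60).

Open Scope R_scope.

(** * Finite sums of reals *)

Section RealSums.
Variables (I : Type) (r : seq I) (P : pred I).

Lemma rsum_scal c (F : I -> R) :
  \rsum_(i <- r | P i) (c * F i) = c * \rsum_(i <- r | P i) F i.
Proof.
by rewrite (big_morph (Rmult c) (Rmult_plus_distr_l c) (Rmult_0_r c)).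
Qed.

Lemma rsum_opp (F : I -> R) :
  \rsum_(i <- r | P i) (- F i) = - \rsum_(i <- r | P i) F i.
Proof. by rewrite (big_morph Ropp Ropp_plus_distr Ropp_0). Qed.

Lemma rsum_sub (F G : I -> R) :
  \rsum_(i <- r | P i) (F i - G i)
  = \rsum_(i <- r | P i) F i - \rsum_(i <- r | P i) G i.
Proof. by rewrite /Rminus -rsum_opp -big_split. Qed.

Lemma rsum_le (F G : I -> R) : (forall i, P i -> F i <= G i) ->
  \rsum_(i <- r | P i) F i <= \rsum_(i <- r | P i) G i.
Proof.
move=> le_FG; elim/big_ind2: _ => [|x y z t lexy lezt|i Pi]; last exact: le_FG.
- exact: Rle_refl.
- exact: Rplus_le_compat.
Qed.

Lemma rsum_ge0 (F : I -> R) : (forall i, P i -> 0 <= F i) ->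
  0 <= \rsum_(i <- r | P i) F i.
Proof.
move=> F_ge0; elim/big_ind: _ => [|x y x0 y0|i Pi]; last exact: F_ge0.
- exact: Rle_refl.
- exact: Rplus_le_le_0_compat.
Qed.

Lemma rsum_abs (F : I -> R) :
  Rabs (\rsum_(i <- r | P i) F i) <= \rsum_(i <- r | P i) Rabs (F i).
Proof.
elim/big_ind2: _ => [|x y z t lexy lezt|i _].
- by rewrite Rabs_R0; exact: Rle_refl.
- exact: Rle_trans (Rabs_triang _ _) (Rplus_le_compat _ _ _ _ lexy lezt).
- exact: Rle_refl.
Qed.

Lemma rsum_const c : \rsum_(i <- r | P i) c = INR (count P r) * c.
Proof.
elim: r => [|i s IHs]; first by rewrite big_nil /= Rmult_0_l.
rewrite big_cons IHs -[count P (i :: s)]/(P i + count P s)%N plus_INR.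
by case: (P i) => /=; ring.
Qed.

End RealSums.

Lemma rsum_ord_const n c : \rsum_(i < n) c = INR n * c.
Proof.
rewrite rsum_const count_predT; congr (INR _ * _).
by rewrite -[RHS]card_ord cardE enumT.
Qed.

Lemma rsum_card_const (T : finType) (A : {pred T}) c :
  \rsum_(i in A) c = INR #|A| * c.
Proof.
rewrite big_const; elim: #|A| => [|m IHm]; first by rewrite /= Rmult_0_l.
by rewrite iterS IHm S_INR; ring.
Qed.

Lemma rsum_ord_le n (F G : nat -> R) : (forall i, (i < n)%N -> F i <= G i) ->
  \rsum_(i < n) F i <= \rsum_(i < n) G i.
Proof. by move=> le_FG; apply: rsum_le => i _; apply: le_FG. Qed.

Lemma perm_eq_rem (T : eqType) (x : T) (s t : seq T) :
  perm_eq s t -> perm_eq (rem x s) (rem x t).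
Proof.
move=> st; case: (boolP (x \in s)) => xs; last first.
  by rewrite !rem_id // -(perm_mem st).
have xt : x \in t by rewrite -(perm_mem st).
rewrite -(perm_cons x) -(permPl (perm_to_rem xs)).
exact: perm_trans st (perm_to_rem xt).
Qed.

Lemma perm_eq_swap (T : eqType) (x y : T) (s : seq T) :
  perm_eq (x :: y :: s) (y :: x :: s).
Proof. exact: permEl (perm_catCA [:: x] [:: y] s). Qed.

(** * The insertion recursion on symmetric functionals *)

Definition symmetric_seq (F : seq nat -> R) : Prop :=
  forall t u, perm_eq t u -> F t = F u.

Definition enlarge (F : seq nat -> R) (t : seq nat) : R :=
  \rsum_(l <- t) (INR l * F (l.+1 :: rem l t)).

(* The mean of a symmetric F over the cycle type of a uniform permutation of n
   points, built by inserting the points one at a time: a new point is either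
   fixed or enlarges some cycle of length l, in l ways. *)
Fixpoint cycle_mean (n : nat) (F : seq nat -> R) : R :=
  if n is m.+1 then
    (cycle_mean m (fun t => F (1%N :: t)) + cycle_mean m (enlarge F)) / INR m.+1
  else F [::].

Lemma symmetric_cons F l : symmetric_seq F -> symmetric_seq (fun t => F (l :: t)).
Proof. by move=> sF t u tu; apply: sF; rewrite perm_cons. Qed.

Lemma enlarge_symmetric F : symmetric_seq F -> symmetric_seq (enlarge F).
Proof.
move=> sF t u tu; rewrite /enlarge (perm_big _ tu) /=.
apply: eq_bigr => l _; congr (_ * _); apply: sF; rewrite perm_cons.
exact: perm_eq_rem.
Qed.

Lemma enlarge_cons F l t : symmetric_seq F ->
  enlarge F (l :: t) = INR l * F (l.+1 :: t) + enlarge (fun u => F (l :: u)) t.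
Proof.
move=> sF; rewrite /enlarge big_cons /= eqxx; congr (_ + _).
rewrite [LHS]big_seq [RHS]big_seq; apply: eq_bigr => k kt; congr (_ * _); apply: sF.
(* If k = l, [rem] deletes the head instead of the copy in t; the two lists are still permutations
   of each other. *)
case: eqP => [->|_]; last exact: perm_eq_swap.
by rewrite (permPr (perm_eq_swap _ _ _)) perm_cons perm_to_rem.
Qed.

Lemma cycle_mean_ext n F G : (forall t, F t = G t) -> cycle_mean n F = cycle_mean n G.
Proof.
elim: n F G => [|n IHn] F G eFG /=; first exact: eFG.
congr (_ / _); congr (_ + _); apply: IHn => t //.
by apply: eq_bigr => l _; rewrite eFG.
Qed.

Lemma cycle_mean_add n F G :
  cycle_mean n (fun t => F t + G t) = cycle_mean n F + cycle_mean n G.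
Proof.
elim: n F G => [|n IHn] F G //; rewrite /cycle_mean -/cycle_mean IHn.
have -> : cycle_mean n (enlarge (fun t => F t + G t))
        = cycle_mean n (enlarge F) + cycle_mean n (enlarge G).
  rewrite -IHn; apply: cycle_mean_ext => t.
  by rewrite /enlarge -big_split; apply: eq_bigr => l _ /=; ring.
by rewrite /Rdiv; ring.
Qed.

Lemma cycle_mean_scal n c F :
  cycle_mean n (fun t => c * F t) = c * cycle_mean n F.
Proof.
elim: n F => [|n IHn] F //; rewrite /cycle_mean -/cycle_mean IHn.
have -> : cycle_mean n (enlarge (fun t => c * F t)) = c * cycle_mean n (enlarge F).
  rewrite -IHn; apply: cycle_mean_ext => t.
  by rewrite /enlarge -rsum_scal; apply: eq_bigr => l _ /=; ring.
by rewrite /Rdiv; ring.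
Qed.

Lemma cycle_mean_le n F G : (forall t, F t <= G t) -> cycle_mean n F <= cycle_mean n G.
Proof.
elim: n F G => [|n IHn] F G leFG; first exact: leFG.
rewrite /cycle_mean -/cycle_mean; apply: Rmult_le_compat_r.
  by apply/Rlt_le/Rinv_0_lt_compat/lt_0_INR/ltP.
apply: Rplus_le_compat; apply: IHn => t //.
by apply: rsum_le => l _; apply: Rmult_le_compat_l => //; apply: pos_INR.
Qed.

(** The definition solved for its second term; this is how [enlarge] is eliminated in
    [cycle_mean_rec]. *)
Lemma cycle_mean_enlarge m G :
  cycle_mean m (enlarge G)
  = INR m.+1 * cycle_mean m.+1 G - cycle_mean m (fun t => G (1%N :: t)).
Proof. by rewrite [cycle_mean m.+1 G]/cycle_mean -/cycle_mean; field; apply: not_0_INR. Qed.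

(** The uniform length of the cycle through a given point, obtained from insertion by induction
    alone: the hypothesis is applied both to [enlarge F] and to F with a fixed point added. *)
Lemma cycle_mean_rec n F : symmetric_seq F ->
  INR n * cycle_mean n F = \rsum_(m < n) cycle_mean m (fun t => F ((n - m)%N :: t)).
Proof.
elim: n F => [|n IHn] F sF; first by rewrite big_ord0 Rmult_0_l.
have -> : INR n.+1 * cycle_mean n.+1 F
   = cycle_mean n (fun t => F (1%N :: t)) + cycle_mean n (enlarge F).
  by rewrite cycle_mean_enlarge; ring.
rewrite big_ord_recr /= subSnn Rplus_comm; congr (_ + _).
case: n IHn => [|n] IHn; first by rewrite big_ord0 /= /enlarge big_nil.
set N := n.+1 in IHn *.
have N0 : INR N <> 0 by apply: not_0_INR.
apply: (Rmult_eq_reg_l (INR N)) => //.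
rewrite IHn; last exact: enlarge_symmetric.
pose a m := cycle_mean m (fun t => F ((N.+1 - m)%N :: t)).
(* Shifting the index in the middle term combines the weights N - m and m into N and leaves N * a N,
   which the last term cancels. *)
transitivity (\rsum_(m < N) (INR (N - m) * a m + (INR m.+1 * a m.+1
   - cycle_mean m (fun t => F (1%N :: ((N - m)%N :: t)))))).
  apply: eq_bigr => m _.
  rewrite (cycle_mean_ext _ (fun t => enlarge_cons _ t sF)) cycle_mean_add.
  rewrite cycle_mean_scal cycle_mean_enlarge /a subSS subSn; last exact: ltnW.
  rewrite /Rminus; congr (_ + (_ + - _)); apply: cycle_mean_ext => t.
  by apply: sF; exact: perm_eq_swap.
rewrite big_split rsum_sub.
rewrite -(IHn (fun t => F (1%N :: t))); last exact: symmetric_cons.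
have -> : \rsum_(m < N) (INR m.+1 * a m.+1) = \rsum_(m < N) (INR m * a m) + INR N * a N.
  transitivity (\rsum_(m < N.+1) (INR m * a m)); last by rewrite big_ord_recr.
  by rewrite big_ord_recl /= Rmult_0_l Rplus_0_l.
have -> : INR N * cycle_mean N (fun t => F (1%N :: t)) = INR N * a N.
  by rewrite /a subSnn.
rewrite /Rminus Rplus_assoc Rplus_opp_r Rplus_0_r -rsum_scal -big_split.
apply: eq_bigr => m _; rewrite [LHS]/=.
by rewrite minus_INR -/(a m); [ring | apply/leP/ltnW].
Qed.

Lemma cycle_mean_const n c : cycle_mean n (fun=> c) = c.
Proof.
elim/ltn_ind: n => [[|n]] IHn //.
apply: (Rmult_eq_reg_l (INR n.+1)); last by apply: not_0_INR.
rewrite cycle_mean_rec // -rsum_ord_const; apply: eq_bigr => m _; exact: IHn.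
Qed.

(** * Cycle types of permutations *)

(** Relative to S, so that the points can be added one at a time inside a single type; fixed points
    in S contribute entries 1. *)
Definition cycle_lengths (T : finType) (S : {set T}) (h : {perm T}) : seq nat :=
  [seq #|(C : {set T})| | C <- enum (porbit h @: S)].

Lemma perm_enum_setU1 (T : finType) (x : T) (A : {set T}) :
  x \notin A -> perm_eq (enum (x |: A)) (x :: enum A).
Proof.
move=> xA; apply: uniq_perm; first exact: enum_uniq.
  by rewrite /= enum_uniq mem_enum xA.
by move=> y; rewrite inE !mem_enum !inE.
Qed.

Lemma porbit_subset_closed (T : finType) (s : {perm T}) (x : T) (A : {set T}) :
  x \in A -> (forall y, y \in A -> s y \in A) -> porbit s x \subset A.
Proof.
move=> xA sA; apply/subsetP => y /porbitP[i ->].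
elim: i => [|i IHi]; first by rewrite expg0 perm1.
by rewrite expgSr permM sA.
Qed.

Lemma mem_porbit1 (T : finType) (s : {perm T}) (x y : T) :
  y \in porbit s x -> s y \in porbit s x.
Proof. by move=> /porbitP[i ->]; rewrite -permM -expgSr mem_porbit. Qed.

Lemma porbit_perm_on (T : finType) (S : {set T}) (h : {perm T}) x :
  perm_on S h -> x \in S -> porbit h x \subset S.
Proof. by move=> hS xS; apply: porbit_subset_closed => // y; rewrite perm_closed. Qed.

Section Insertion.
Variables (T : finType) (S : {set T}) (z y : T) (h : {perm T}).
Hypotheses (zS : z \notin S) (hS : perm_on S h) (yS : y \in S).
(** Products act from left to right: y goes to z and z to the former image of y, so z enters the
    cycle of y just after y. *)
Let h' := (tperm z y * h)%g.

Let hz : h z = z. Proof. exact: out_perm hS zS. Qed.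

Lemma insert_perm_new : h' z = h y. Proof. by rewrite permM tpermL. Qed.
Lemma insert_perm_pred : h' y = z. Proof. by rewrite permM tpermR hz. Qed.
Lemma insert_perm_other x : x != z -> x != y -> h' x = h x.
Proof. by move=> xz xy; rewrite permM tpermD // eq_sym. Qed.

Lemma porbit_insert_sub x : x \in S -> porbit h x \subset porbit h' x.
Proof.
move=> xS; have: porbit h x \subset porbit h' x :&: S.
  apply: porbit_subset_closed; first by rewrite inE porbit_id.
  move=> w /setIP[wx wS]; rewrite inE (perm_closed w hS) wS andbT.
  have wz : w != z by apply: contraTneq wS => ->.
  have [wy|wy] := eqVneq w y; last by rewrite -insert_perm_other // mem_porbit1.
  by rewrite wy -insert_perm_new -insert_perm_pred -wy !mem_porbit1.
by move=> /subset_trans; apply; exact: subsetIl.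
Qed.

Lemma porbit_insert_pred : porbit h' y = z |: porbit h y.
Proof.
apply/eqP; rewrite eqEsubset; apply/andP; split.
  apply: porbit_subset_closed; first by rewrite inE porbit_id orbT.
  move=> w; rewrite 2!inE => /orP[/eqP->|wy].
    by rewrite insert_perm_new inE mem_porbit1 ?orbT // porbit_id.
  have [->|ny] := eqVneq w y; first by rewrite insert_perm_pred inE set11.
  have wz : w != z.
    apply: contraTneq wy => ->; apply: contra zS => /(subsetP (porbit_perm_on hS yS)) //.
  by rewrite insert_perm_other // inE mem_porbit1 ?orbT.
rewrite subUset porbit_insert_sub // andbT sub1set -insert_perm_pred.
by rewrite mem_porbit1 // porbit_id.
Qed.

Lemma porbit_insert_new : porbit h' z = z |: porbit h y.
Proof.
rewrite -porbit_insert_pred; apply/eqP; rewrite eq_sym eq_porbit_mem porbit_sym.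
by rewrite porbit_insert_pred setU11.
Qed.

Lemma porbit_insert_other x : x \in S -> x \notin porbit h y -> porbit h' x = porbit h x.
Proof.
move=> xS xy; apply/eqP; rewrite eqEsubset porbit_insert_sub // andbT.
apply: porbit_subset_closed; first exact: porbit_id.
move=> w wx.
have wz : w != z.
  apply: contraTneq wx => ->; apply: contra zS => /(subsetP (porbit_perm_on hS xS)) //.
have wy : w != y.
  by apply: contraTneq wx => ->; rewrite porbit_sym.
by rewrite insert_perm_other // mem_porbit1.
Qed.

Lemma porbits_insert : porbit h' @: (z |: S)
  = (z |: porbit h y) |: ((porbit h @: S) :\ porbit h y).
Proof.
apply/setP => C; apply/imsetP/idP => [[x]|].
  rewrite 2!inE => /orP[/eqP-> ->|xS ->]; first by rewrite porbit_insert_new setU11.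
  have [xy|xy] := boolP (x \in porbit h y).
    have /eqP-> : porbit h' x == porbit h' y.
      by rewrite eq_porbit_mem porbit_insert_pred inE xy orbT.
    by rewrite porbit_insert_pred setU11.
  rewrite porbit_insert_other // !inE imset_f // andbT orbC.
  by rewrite eq_porbit_mem xy.
rewrite 2!inE => /orP[/eqP->|]; first by exists z; rewrite ?setU11 // porbit_insert_new.
rewrite inE => /andP[Cy /imsetP[x xS eC]]; exists x; first by rewrite inE xS orbT.
by rewrite porbit_insert_other // -eq_porbit_mem -eC -in_set1.
Qed.

Lemma cycle_lengths_insert :
  perm_eq (cycle_lengths (z |: S) h')
          (#|porbit h y|.+1 :: rem #|porbit h y| (cycle_lengths S h)).
Proof.
have zC x : x \in S -> z \notin porbit h x.
  by move=> xS; apply: contra zS => /(subsetP (porbit_perm_on hS xS)).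
(* The enlarged orbit is a new set because it alone contains z, so passing from the set of orbits to
   the list of sizes loses no multiplicity. *)
have nin : z |: porbit h y \notin (porbit h @: S) :\ porbit h y.
  rewrite inE negb_and; apply/orP; right; apply/imsetP => -[x xS e].
  by have := zC x xS; rewrite -e setU11.
rewrite /cycle_lengths porbits_insert.
apply: perm_trans (perm_map _ (perm_enum_setU1 nin)) _.
rewrite /= cardsU1 zC // add1n perm_cons.
set Cy := porbit h y; have CyS : Cy \in porbit h @: S by exact: imset_f.
have := perm_enum_setU1 (negbT (setD11 Cy (porbit h @: S))).
rewrite setD1K // => /(perm_map (fun C : {set T} => #|C|)) e.
by rewrite perm_sym (permPl (perm_eq_rem _ e)) /= eqxx.
Qed.

End Insertion.

Lemma cycle_lengths_fixed (T : finType) (S : {set T}) (z : T) (h : {perm T}) :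
  z \notin S -> perm_on S h ->
  perm_eq (cycle_lengths (z |: S) h) (1%N :: cycle_lengths S h).
Proof.
move=> zS hS; have hz : h z = z by exact: out_perm hS zS.
have pz : porbit h z = [set z].
  apply/eqP; rewrite eqEsubset sub1set porbit_id andbT.
  by apply: porbit_subset_closed; rewrite ?set11 // => w /set1P->; rewrite hz set11.
rewrite /cycle_lengths imsetU1 pz -[X in X :: map _ _](cards1 z).
apply: perm_map (perm_enum_setU1 _).
apply/imsetP => -[x xS e]; have := porbit_perm_on hS xS.
by rewrite -e sub1set (negPf zS).
Qed.

Section SumPerm.
Variable T : finType.
Implicit Types (S : {set T}) (F : seq nat -> R).

(** A permutation of z and S factors uniquely as [tperm z y * h], where y is the preimage of z and h
    fixes z; y = z is the case of a new fixed point. *)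
Lemma sum_perm_on_setU1 S z F : z \notin S ->
  \rsum_(h : {perm T} | perm_on (z |: S) h) F (cycle_lengths (z |: S) h)
  = \rsum_(y in z |: S) \rsum_(h : {perm T} | perm_on S h)
      F (cycle_lengths (z |: S) (tperm z y * h)%g).
Proof.
move=> zS.
rewrite (partition_big (fun h : {perm T} => (h^-1)%g z) (mem (z |: S))) /=; last first.
  by move=> h hS; rewrite perm_closed ?setU11 // perm_onV.
apply: eq_bigr => y yS.
rewrite (reindex_inj (mulgI (tperm z y))) /=; apply: eq_bigl => h.
have ty : perm_on (z |: S) (tperm z y).
  apply/subsetP => x; rewrite inE; case: tpermP => [->|->|]; rewrite ?eqxx // => _.
  exact: setU11.
apply/andP/idP => [[hS /eqP e]|hS].
  have hz : h z = z by have := permKV (tperm z y * h)%g z; rewrite e permM tpermR.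
  have hzS : perm_on (z |: S) h.
    by have := perm_onM ty hS; rewrite mulgA tperm2 mul1g.
  apply/subsetP => x; rewrite inE => hx.
  have := subsetP hzS x; rewrite !inE hx => /(_ isT) /orP[/eqP xz|//].
  by move: hx; rewrite xz hz eqxx.
split.
  apply: perm_onM ty _; apply: subset_trans hS _; exact: subsetUr.
by rewrite -(inj_eq (@perm_inj _ (tperm z y * h)%g)) permKV permM tpermR (out_perm hS zS).
Qed.

Lemma sum_cycle_lengths S F : symmetric_seq F ->
  \rsum_(h : {perm T} | perm_on S h) F (cycle_lengths S h)
  = INR (#|S|)`! * cycle_mean #|S| F.
Proof.
move: {2}#|S| (erefl #|S|) => n; elim: n S F => [|n IHn] S F cardS sF.
  have -> : S = set0 by apply/eqP; rewrite -cards_eq0 cardS.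
  rewrite cards0 (big_pred1 1%g) /=; last first.
    move=> h /=; apply/idP/eqP => [h0|->]; last exact: perm_on1.
    by apply/permP => x; rewrite perm1 (out_perm h0) // inE.
  by rewrite /cycle_lengths imset0 enum_set0 Rmult_1_l.
have [z zS] : exists z, z \in S by apply/set0Pn; rewrite -cards_eq0 cardS.
rewrite -(setD1K zS); set S' := S :\ z.
have zS' : z \notin S' by rewrite setD11.
have cS' : #|S'| = n by move: cardS; rewrite (cardsD1 z) zS add1n => -[].
have cU : #|z |: S'| = n.+1 by rewrite setD1K.
rewrite sum_perm_on_setU1 // cU big_setU1 // [LHS]/=.
have -> : \rsum_(h : {perm T} | perm_on S' h) F (cycle_lengths (z |: S') (tperm z z * h)%g)
  = INR n`! * cycle_mean n (fun t => F (1%N :: t)).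
  rewrite -{1 2}cS' -IHn //; last exact: symmetric_cons.
  apply: eq_bigr => h hS; rewrite tperm1 mul1g; apply: sF.
  exact: cycle_lengths_fixed.
rewrite exchange_big /=.
have -> : \rsum_(h : {perm T} | perm_on S' h) \rsum_(y in S')
    F (cycle_lengths (z |: S') (tperm z y * h)%g)
  = INR n`! * cycle_mean n (enlarge F).
  rewrite -{1 2}cS' -IHn //; last exact: enlarge_symmetric.
  apply: eq_bigr => h hS.
  transitivity (\rsum_(y in S')
     F (#|porbit h y|.+1 :: rem #|porbit h y| (cycle_lengths S' h))).
    by apply: eq_bigr => y yS; apply: sF; exact: cycle_lengths_insert.
  rewrite /enlarge {2}/cycle_lengths big_map big_enum /=.
  (* All points y of one orbit give the same list, so an orbit of size l is counted l times: this is
     the weight in [enlarge]. *)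
  rewrite (partition_big_imset (porbit h)) /=.
  apply: eq_bigr => C /imsetP[x xS ->].
  transitivity (\rsum_(y in porbit h x)
     F (#|porbit h x|.+1 :: rem #|porbit h x| (cycle_lengths S' h))); last first.
    by rewrite rsum_card_const.
  apply: congr_big => //.
  - move=> y; rewrite eq_porbit_mem; case: (boolP (y \in porbit h x)) => yx; rewrite ?andbF //.
    by rewrite (subsetP (porbit_perm_on hS xS)).
  - by move=> y /andP[_ /eqP->].
rewrite factS mult_INR -/(INR n.+1).
by field; apply: not_0_INR.
Qed.
End SumPerm.

Lemma sum_perm_cycle_mean n F : symmetric_seq F ->
  \rsum_(h : {perm 'I_n}) F (cycle_lengths setT h) = INR n`! * cycle_mean n F.
Proof.
move=> sF; have := @sum_cycle_lengths 'I_n setT F sF.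
rewrite cardsT card_ord => <-; apply: eq_bigl => h.
by apply/esym/subsetP => x; rewrite inE.
Qed.

(** * Product against lcm of the cycle lengths *)

Lemma INR_leq m n : (m <= n)%N -> INR m <= INR n.
Proof. by move=> /leP/le_INR. Qed.

Lemma INR_gt0 n : (0 < n)%N -> 0 < INR n.
Proof. by move=> /ltP/lt_0_INR. Qed.

Lemma ln_le_sub1 x : 0 < x -> ln x <= x - 1.
Proof. by move=> x0; have := exp_ineq1_le (ln x); rewrite exp_ln //; lra. Qed.

Lemma ln_ge0 x : 1 <= x -> 0 <= ln x.
Proof.
move=> x1; rewrite -ln_1; case: x1 => [x1|<-]; last exact: Rle_refl.
by apply/Rlt_le/ln_increasing; lra.
Qed.

Lemma ln_INR_ge0 n : 0 <= ln (INR n).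
Proof.
(* [ln] takes the default value 0 at 0. *)
case: n => [|n]; first by rewrite /ln /=; case: Rlt_dec => [/Rlt_irrefl//|_]; exact: Rle_refl.
by apply: ln_ge0; rewrite S_INR; have := pos_INR n; lra.
Qed.

Lemma ln_INR_le m n : (m <= n)%N -> ln (INR m) <= ln (INR n).
Proof.
case: m => [|m] mn.
  rewrite {1}/ln /=; case: Rlt_dec => [/Rlt_irrefl//|_]; exact: ln_INR_ge0.
have [->|ne] := eqVneq m.+1 n; first exact: Rle_refl.
apply/Rlt_le/ln_increasing; first exact: INR_gt0.
by apply/lt_INR/ltP; rewrite ltn_neqAle ne.
Qed.

Lemma ln_INR_succ_ge n : (0 < n)%N -> / INR n.+1 <= ln (INR n.+1) - ln (INR n).
Proof.
move=> n0; have p0 := INR_gt0 n0; have p1 : 0 < INR n.+1 by exact: INR_gt0.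
have := @ln_le_sub1 (INR n / INR n.+1) (Rdiv_lt_0_compat _ _ p0 p1).
rewrite ln_div //; move: p1; rewrite S_INR => p1.
have -> : INR n / (INR n + 1) - 1 = - / (INR n + 1) by field; lra.
by lra.
Qed.

Lemma ln_INR_succ_le n : (0 < n)%N -> ln (INR n.+1) - ln (INR n) <= / INR n.
Proof.
move=> n0; have p0 := INR_gt0 n0; have p1 : 0 < INR n.+1 by exact: INR_gt0.
have := @ln_le_sub1 (INR n.+1 / INR n) (Rdiv_lt_0_compat _ _ p1 p0).
rewrite ln_div //; move: p1; rewrite S_INR => p1.
have -> : (INR n + 1) / INR n - 1 = / INR n by field; lra.
by lra.
Qed.

Definition harmonic n : R := \rsum_(i < n) / INR i.+1.

Lemma harmonicS n : harmonic n.+1 = harmonic n + / INR n.+1.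
Proof. by rewrite /harmonic big_ord_recr. Qed.

Lemma inv_INR_ge0 n : 0 <= / INR n.
Proof.
case: n => [|n]; first by rewrite /= Rinv_0; exact: Rle_refl.
exact/Rlt_le/Rinv_0_lt_compat/INR_gt0.
Qed.

Lemma harmonic_ge0 n : 0 <= harmonic n.
Proof. by apply: rsum_ge0 => i _; exact: inv_INR_ge0. Qed.

Lemma harmonic_le m n : (m <= n)%N -> harmonic m <= harmonic n.
Proof.
elim: n => [|n IHn]; first by rewrite leqn0 => /eqP->; exact: Rle_refl.
rewrite leq_eqVlt => /orP[/eqP->|]; first exact: Rle_refl.
by rewrite ltnS harmonicS => /IHn; have := inv_INR_ge0 n.+1; lra.
Qed.

Lemma harmonic_sum n : \rsum_(m < n) harmonic m = INR n * harmonic n - INR n.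
Proof.
elim: n => [|n IHn]; first by rewrite big_ord0 /=; ring.
rewrite big_ord_recr IHn harmonicS /=; rewrite -/(INR n.+1) S_INR; field.
by have := pos_INR n; lra.
Qed.

Lemma harmonic_ln n : (0 < n)%N -> harmonic n <= 1 + ln (INR n).
Proof.
elim: n => [//|[|n] IHn] _.
  by rewrite /harmonic big_ord_recr big_ord0 /= ln_1 Rinv_1; lra.
by rewrite harmonicS; have := IHn isT; have := @ln_INR_succ_ge n.+1 isT; lra.
Qed.

(** c * H_n solves the recursion with equality, by [harmonic_sum]. The cut-off N lets c depend on
    the largest index, as the second moment requires. *)
Lemma mean_recursion_bound (u : nat -> R) c N : 0 <= c -> u 0%N <= 0 ->
  (forall n, (0 < n <= N)%N -> INR n * u n <= INR n * c + \rsum_(m < n) u m) ->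
  forall n, (n <= N)%N -> u n <= c * harmonic n.
Proof.
move=> c0 u0 rec; elim/ltn_ind => [[|n]] IHn nN.
  by rewrite /harmonic big_ord0 Rmult_0_r.
have p0 : 0 < INR n.+1 by exact: INR_gt0.
apply: (Rmult_le_reg_l (INR n.+1)) => //.
apply: Rle_trans (rec n.+1 nN) _.
have : \rsum_(m < n.+1) u m <= \rsum_(m < n.+1) (c * harmonic m).
  by apply: (@rsum_ord_le n.+1 u (fun m => c * harmonic m)) => m mn; apply: IHn => //; apply: leq_trans (ltnW mn) _.
rewrite rsum_scal harmonic_sum; lra.
Qed.

Lemma INR_sum (I : Type) (r : seq I) (P : pred I) (F : I -> nat) :
  INR (\sum_(i <- r | P i) F i)%N = \rsum_(i <- r | P i) INR (F i).
Proof. exact: (big_morph INR plus_INR). Qed.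

(** * Moments of the number of cycle lengths divisible by q *)

Section DivisibleCycles.
Variables (q : nat).
Hypothesis (q0 : (0 < q)%N).

Let Dq (t : seq nat) := count (dvdn q) t.

Lemma Dq_symmetric (f : nat -> R) : symmetric_seq (fun t => f (Dq t)).
Proof. by move=> t u /seq.permP tu; rewrite /Dq tu. Qed.

Lemma sum_dvdn_le n : \rsum_(m < n) INR (q %| n - m)%N <= INR n / INR q.
Proof.
have q1 := INR_gt0 q0.
rewrite -INR_sum (_ : (\sum_(m < n) _)%N = (n %/ q)%N); last first.
  rewrite divn_count_dvd big_add1 /= big_mkord.
  rewrite (reindex_inj rev_ord_inj) /=; apply: eq_bigr => i _.
  by rewrite subKn.
apply: (Rmult_le_reg_r (INR q)) => //.
have -> : INR n / INR q * INR q = INR n by field; lra.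
by rewrite -mult_INR; apply: INR_leq; exact: leq_trunc_div.
Qed.

Lemma cycle_mean_Dq n : cycle_mean n (fun t => INR (Dq t)) <= harmonic n / INR q.
Proof.
have q1 := INR_gt0 q0.
rewrite /Rdiv Rmult_comm.
apply: (@mean_recursion_bound (fun n => cycle_mean n (fun t => INR (Dq t))) _ n) => //.
- exact: inv_INR_ge0.
- exact: Rle_refl.
move=> m /andP[m0 _]; rewrite cycle_mean_rec; last exact: (Dq_symmetric INR).
have := sum_dvdn_le m; rewrite /Rdiv => le1.
apply: Rle_trans (Rplus_le_compat_r _ _ _ le1).
rewrite -big_split; apply: rsum_le => i _ /=.
rewrite (@cycle_mean_ext _ _ (fun t => INR (q %| m - i)%N + INR (Dq t))); last first.
  by move=> t; rewrite /Dq /= plus_INR.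
by rewrite cycle_mean_add cycle_mean_const; exact: Rle_refl.
Qed.

Lemma cycle_mean_Dq2 n :
  cycle_mean n (fun t => INR (Dq t) * (INR (Dq t) - 1))
    <= 2 * (harmonic n / INR q) ^ 2.
Proof.
have q1 := INR_gt0 q0; have h0 := harmonic_ge0 n; have iq := inv_INR_ge0 q.
pose b m := cycle_mean m (fun t => INR (Dq t) * (INR (Dq t) - 1)).
have -> : 2 * (harmonic n / INR q) ^ 2 = (2 * (harmonic n / INR q) * / INR q) * harmonic n.
  by field; lra.
have c0 : 0 <= 2 * (harmonic n / INR q) * / INR q.
  by apply: Rmult_le_pos => //; rewrite /Rdiv; apply: Rmult_le_pos; [lra | exact: Rmult_le_pos].
apply: (@mean_recursion_bound b _ n) => //.
  by rewrite /b /Dq /=; lra.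
move=> m /andP[m0 mn]; rewrite {1}/b cycle_mean_rec; last first.
  exact: (Dq_symmetric (fun k => INR k * (INR k - 1))).
apply: (Rle_trans _ (\rsum_(i < m) (INR (q %| m - i)%N * (2 * (harmonic n / INR q)) + b i))).
  apply: rsum_le => i _ /=.
  (* For e in {0, 1}, (D + e) (D + e - 1) = D (D - 1) + 2 e D. *)
  rewrite (@cycle_mean_ext _ _ (fun t => (2 * INR (q %| m - i)%N) * INR (Dq t)
     + INR (Dq t) * (INR (Dq t) - 1))); last first.
    by move=> t; rewrite /Dq /= plus_INR; case: (q %| m - i)%N => /=; ring.
  rewrite cycle_mean_add cycle_mean_scal -/(b i); apply: Rplus_le_compat_r.
  have := cycle_mean_Dq i; have : harmonic i / INR q <= harmonic n / INR q.
    apply: Rmult_le_compat_r => //; apply: harmonic_le; apply: ltnW.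
    exact: leq_trans (ltn_ord i) mn.
  by case: (q %| m - i)%N => /=; lra.
rewrite big_split; apply: Rplus_le_compat_r.
have -> : \rsum_(i < m) (INR (q %| m - i)%N * (2 * (harmonic n / INR q)))
  = 2 * (harmonic n / INR q) * \rsum_(i < m) INR (q %| m - i)%N.
  by rewrite -rsum_scal; apply: eq_bigr => i _; ring.
have -> : INR m * (2 * (harmonic n / INR q) * / INR q)
  = 2 * (harmonic n / INR q) * (INR m / INR q) by rewrite /Rdiv; ring.
apply: Rmult_le_compat_l; last exact: sum_dvdn_le.
by rewrite /Rdiv; apply: Rmult_le_pos; [lra | exact: Rmult_le_pos].
Qed.

(** Pointwise [D.-1] is at most D and at most D (D - 1) / 2. The first moment serves when a >= 1,
    the second when a < 1. *)
Lemma cycle_mean_Dq_pred n : (0 < n)%N ->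
  cycle_mean n (fun t => INR (Dq t).-1) <= Rpower (harmonic n / INR q) (5 / 4).
Proof.
move=> n0; set a := harmonic n / INR q.
have a0 : 0 < a.
  apply: Rdiv_lt_0_compat; last exact: INR_gt0.
  have := harmonic_le n0; rewrite {1}/harmonic big_ord_recr big_ord0 /= Rinv_1; lra.
have le1 : cycle_mean n (fun t => INR (Dq t).-1) <= a.
  apply: Rle_trans (cycle_mean_Dq n); apply: cycle_mean_le => t.
  by apply: INR_leq; exact: leq_pred.
have le2 : cycle_mean n (fun t => INR (Dq t).-1) <= a ^ 2.
  have := cycle_mean_Dq2 n; rewrite -/a.
  have : cycle_mean n (fun t => 2 * INR (Dq t).-1)
     <= cycle_mean n (fun t => INR (Dq t) * (INR (Dq t) - 1)).
    apply: cycle_mean_le => t; case: (Dq t) => [|[|k]]; rewrite -1?pred_Sn; try by simpl; lra.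
    rewrite !S_INR; have := pos_INR k; nra.
  by rewrite cycle_mean_scal; lra.
case: (Rle_dec 1 a) => a1.
  apply: Rle_trans le1 _; rewrite -{1}(Rpower_1 a) //.
  by apply: Rle_Rpower; lra.
apply: Rle_trans le2 _; rewrite -(Rpower_pow 2 a) // /Rpower.
have la : ln a <= 0 by have := ln_le_sub1 a0; lra.
rewrite [INR 2]/=; case: (Rle_lt_or_eq_dec _ _ la) => [la'|->]; last first.
  by rewrite !Rmult_0_r; exact: Rle_refl.
by apply/Rlt_le/exp_increasing; nra.
Qed.

End DivisibleCycles.

(** Excludes 0 and 1, whose lists of primes are empty. *)
Definition primepow q := size (primes q) == 1%N.

Lemma primepow_pexp p k : prime p -> (0 < k)%N -> primepow (p ^ k).
Proof. by move=> pp k0; rewrite /primepow primesX // primes_prime. Qed.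

(** The p-valuation of an lcm is the maximum of the two valuations. With two prime factors, q could
    be split between a and b. *)
Lemma primepow_dvd_lcm q a b : primepow q -> (0 < a)%N -> (0 < b)%N ->
  (q %| lcmn a b)%N -> (q %| a)%N || (q %| b)%N.
Proof.
move=> /eqP qs a0 b0.
have q0 : (0 < q)%N by case: q qs.
case eqp : (primes q) qs => [//|p [|//]] _.
have pp : prime p by have := mem_primes p q; rewrite eqp mem_seq1 eqxx => /esym/andP[].
have -> : q = (p ^ logn p q)%N.
  rewrite {1}(prod_prime_decomp q0) prime_decompE eqp big_map.
  by rewrite big_cons big_nil muln1.
rewrite !pfactor_dvdn // ?lcmn_gt0 ?a0 // logn_lcm // leq_max; done.
Qed.

Lemma rsum_uniq_sub (s r : seq nat) (P : pred nat) (F : nat -> R) :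
  uniq s -> uniq r -> (forall x, x \in s -> (x \in r) && P x) ->
  (forall x, 0 <= F x) ->
  \rsum_(x <- s) F x <= \rsum_(x <- r | P x) F x.
Proof.
move=> us ur sub F0.
rewrite [X in _ <= X](bigID (fun x => x \in s)) /=.
have -> : \rsum_(i <- r | P i && (i \in s)) F i = \rsum_(x <- s) F x.
  rewrite -big_filter; apply: perm_big; apply: uniq_perm => //.
    exact: filter_uniq.
  move=> x; rewrite mem_filter; case: (boolP (x \in s)) => [/sub/andP[-> ->]//|_].
  by rewrite andbF.
rewrite -[X in X <= _]Rplus_0_r; apply: Rplus_le_compat_l.
exact: rsum_ge0.
Qed.

Lemma ln_prod (s : seq nat) : (forall x, x \in s -> (0 < x)%N) ->
  ln (INR (\prod_(x <- s) x)%N) = \rsum_(x <- s) ln (INR x).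
Proof.
elim: s => [|x s IHs] pos; first by rewrite !big_nil ln_1.
rewrite !big_cons mult_INR ln_mult ?IHs //.
- by move=> y ys; apply: pos; rewrite inE ys orbT.
- by apply/INR_gt0/pos; rewrite mem_head.
apply: INR_gt0; rewrite big_seq prodn_cond_gt0 // => y ys.
by apply: pos; rewrite inE ys orbT.
Qed.

(** The full prime powers p ^ v_p (g) already multiply to g; the remaining terms of the right-hand
    side are nonnegative. *)
Lemma ln_le_sum_primepow g N : (0 < g <= N)%N ->
  ln (INR g) <= \rsum_(2 <= q < N.+1 | primepow q && (q %| g)%N) ln (INR q).
Proof.
move=> /andP[g0 gN].
pose s := [seq (p ^ logn p g)%N | p <- primes g].
have gE : g = (\prod_(x <- s) x)%N.
  by rewrite big_map {1}(prod_prime_decomp g0) prime_decompE big_map.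
have mem_s x : x \in s -> exists2 p, prime p & (x = p ^ logn p g)%N /\ (0 < logn p g)%N.
  move=> /mapP[p pg ->]; exists p; first by move: pg; rewrite mem_primes => /andP[].
  by rewrite logn_gt0.
rewrite {1}gE ln_prod; last first.
  by move=> x /mem_s[p pp [-> _]]; rewrite expn_gt0 prime_gt0.
apply: rsum_uniq_sub; last exact: ln_INR_ge0.
- rewrite map_inj_in_uniq ?primes_uniq // => p p' pg pg' e.
  have [pp l0] : prime p /\ (0 < logn p g)%N.
    by split; [move: pg; rewrite mem_primes => /andP[] | rewrite logn_gt0].
  have [pp' l0'] : prime p' /\ (0 < logn p' g)%N.
    by split; [move: pg'; rewrite mem_primes => /andP[] | rewrite logn_gt0].
  have : (p %| p' ^ logn p' g)%N by rewrite -e dvdn_exp.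
  by rewrite Euclid_dvdX // dvdn_prime2 // => /andP[/eqP].
- exact: iota_uniq.
move=> x /mem_s[p pp [ex l0]].
have xg : (x %| g)%N by rewrite ex pfactor_dvdnn.
rewrite mem_index_iota xg andbT ltnS (leq_trans (dvdn_leq g0 xg) gN) andbT.
rewrite {2}ex primepow_pexp // andbT ex.
apply: leq_trans (prime_gt1 pp) _; rewrite -{1}(expn1 p).
by rewrite leq_exp2l // prime_gt1.
Qed.

Definition lcm_seq (t : seq nat) := (\big[lcmn/1]_(l <- t) l)%N.

Lemma lcm_seq_gt0 t : all (leq 1) t -> (0 < lcm_seq t)%N.
Proof.
rewrite /lcm_seq; elim: t => [|l t IHt]; first by rewrite big_nil.
by rewrite big_cons /= => /andP[l0 /IHt]; rewrite lcmn_gt0 l0.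
Qed.

Lemma primepow_dvd_lcm_seq q t : (1 < q)%N -> primepow q -> all (leq 1) t ->
  (q %| lcm_seq t)%N -> (0 < count (dvdn q) t)%N.
Proof.
move=> q1 ppq; elim: t => [|l t IHt].
  by rewrite /lcm_seq big_nil dvdn1 => _ /eqP e; rewrite e in q1.
move=> /= /andP[l0 t0]; rewrite /lcm_seq big_cons -/(lcm_seq t) => dv.
have /orP[-> //|/(IHt t0) c0] := primepow_dvd_lcm ppq l0 (lcm_seq_gt0 t0) dv.
by rewrite addn_gt0 c0 orbT.
Qed.

Definition sum_ln (t : seq nat) : R := \rsum_(l <- t) ln (INR l).

(* Bounds ln (prod t / lcm t): a prime power dividing D > 1 entries of t
   is counted once in the lcm and D times in the product. *)
Definition lcm_defect N (t : seq nat) : R :=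
  \rsum_(2 <= q < N.+1 | primepow q) (ln (INR q) * INR (count (dvdn q) t).-1).

(** Adding an entry l to a list with lcm m loses log gcd (l, m). A prime power dividing this gcd
    divides l and, by [primepow_dvd_lcm_seq], an earlier entry, so its truncated count rises by
    one. *)
Lemma lcm_defect_ge N t : all (fun l => 0 < l <= N)%N t ->
  sum_ln t - ln (INR (lcm_seq t)) <= lcm_defect N t.
Proof.
elim: t => [|l t IHt] /=.
  rewrite /sum_ln /lcm_seq !big_nil ln_1 => _.
  have : 0 <= lcm_defect N [::]; last lra.
  by apply: rsum_ge0 => q _; apply: Rmult_le_pos; [exact: ln_INR_ge0 | exact: pos_INR].
move=> /andP[/andP[l0 lN] tN].
have t1 : all (leq 1) t by apply: sub_all tN => x /andP[].
have m0 := lcm_seq_gt0 t1.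
have := IHt tN; rewrite /sum_ln /lcm_seq !big_cons -/(sum_ln t) -/(lcm_seq t).
set m := lcm_seq t in m0 *.
have g0 : (0 < gcdn l m)%N by rewrite gcdn_gt0 l0.
have gN : (0 < gcdn l m <= N)%N.
  by rewrite g0 (leq_trans (dvdn_leq l0 (dvdn_gcdl l m)) lN).
have e : ln (INR (lcmn l m)) + ln (INR (gcdn l m)) = ln (INR l) + ln (INR m).
  rewrite -!ln_mult -?mult_INR; try exact: INR_gt0.
    by rewrite (muln_lcm_gcd l m : (_ * _)%coq_nat = _).
  by apply: INR_gt0; rewrite lcmn_gt0 l0.
have := ln_le_sum_primepow gN.
have : \rsum_(2 <= q < N.+1 | primepow q && (q %| gcdn l m)%N) ln (INR q)
   + lcm_defect N t <= lcm_defect N (l :: t); last lra.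
rewrite /lcm_defect big_mkcondr -big_split /= big_seq_cond [X in _ <= X]big_seq_cond.
apply: rsum_le => q; rewrite mem_index_iota => /andP[/andP[q1 _] ppq].
rewrite dvdn_gcd; have lnq := ln_INR_ge0 q.
have := pos_INR (count (dvdn q) t).-1 => pc.
case: (boolP (q %| l)%N) => ql /=; last by rewrite add0n; lra.
case: (boolP (q %| m)%N) => qm.
  have c0 := primepow_dvd_lcm_seq q1 ppq t1 qm.
  rewrite add0n -{2}(prednK c0) S_INR; lra.
rewrite add0n Rplus_0_l; apply: Rmult_le_compat_l => //.
by apply: INR_leq; exact: leq_pred.
Qed.

Lemma lcm_defect_symmetric N : symmetric_seq (lcm_defect N).
Proof. by move=> t u /seq.permP tu; apply: eq_bigr => q _; rewrite tu. Qed.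

Lemma cycle_mean_sum (I : Type) (r : seq I) (P : pred I) n (F : I -> seq nat -> R) :
  cycle_mean n (fun t => \rsum_(i <- r | P i) F i t)
  = \rsum_(i <- r | P i) cycle_mean n (F i).
Proof.
elim: r => [|i r IHr].
  by rewrite big_nil -[RHS](cycle_mean_const n R0); apply: cycle_mean_ext => t; rewrite big_nil.
rewrite big_cons -IHr; case: ifP => Pi; last first.
  by apply: cycle_mean_ext => t; rewrite big_cons Pi.
by rewrite -cycle_mean_add; apply: cycle_mean_ext => t; rewrite big_cons Pi.
Qed.

(* Bernoulli turns the series of q^(-9/8) into a telescoping one. *)
Lemma sum_Rpower_bound N :
  \rsum_(2 <= q < N.+1) Rpower (INR q) (- (9 / 8)) <= 8.
Proof.
suff H n : \rsum_(2 <= q < n.+2) Rpower (INR q) (- (9 / 8))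
   <= 8 * (1 - Rpower (INR n.+1) (- (1 / 8))).
  case: N => [|n]; first by rewrite big_geq //; lra.
  have := H n; have : 0 < Rpower (INR n.+1) (- (1 / 8)) by exact: exp_pos.
  lra.
elim: n => [|n IHn].
  by rewrite big_geq // /Rpower ln_1 Rmult_0_r exp_0; lra.
rewrite big_nat_recr //=; set q := INR n.+2.
rewrite -/(INR n.+1) in q *.
have q2 : 2 <= q by rewrite /q !S_INR; have := pos_INR n; lra.
have qe : INR n.+1 = q - 1 by rewrite /q (S_INR n.+1); ring.
have : Rpower q (- (1 / 8)) + / 8 * Rpower q (- (9 / 8)) <= Rpower (INR n.+1) (- (1/8)).
  have -> : INR n.+1 = q * (1 - / q) by rewrite qe; field; lra.
  have iq : 0 < / q by apply: Rinv_0_lt_compat; lra.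
  have iq1 : / q <= / 2 by apply: Rinv_le_contravar; lra.
  rewrite {3}/Rpower ln_mult; [|lra|lra].
  rewrite Rmult_plus_distr_l exp_plus -/(Rpower q (- (1/8))).
  have -> : Rpower q (- (9 / 8)) = Rpower q (- (1/8)) * / q.
    rewrite -(Rpower_1 (/ q)) // /Rpower ln_Rinv; last lra.
    by rewrite -exp_plus; congr exp; lra.
  have := exp_ineq1_le (- (1 / 8) * ln (1 - / q)).
  have : ln (1 - / q) <= - / q by have := @ln_le_sub1 (1 - / q); lra.
  have : 0 < Rpower q (- (1/8)) by exact: exp_pos.
  nra.
rewrite -S_INR -/q; lra.
Qed.

(** The bound log q <= 8 q^(1/8) lowers the exponent 5/4 to 9/8, and the sum over all q >= 2 is then
    at most 8; hence 64. *)
Lemma cycle_mean_lcm_defect n : (0 < n)%N ->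
  cycle_mean n (lcm_defect n) <= 64 * Rpower (harmonic n) (5 / 4).
Proof.
move=> n0; rewrite /lcm_defect cycle_mean_sum.
have H0 : 0 < harmonic n.
  have := harmonic_le n0; rewrite {1}/harmonic big_ord_recr big_ord0 /= Rinv_1; lra.
set h := Rpower (harmonic n) (5 / 4).
have h0 : 0 < h by exact: exp_pos.
apply: (Rle_trans _ (8 * h * \rsum_(2 <= q < n.+1) Rpower (INR q) (- (9 / 8)))); last first.
  by have := sum_Rpower_bound n; nra.
rewrite -rsum_scal big_mkcond /= big_seq_cond [X in _ <= X]big_seq_cond.
apply: rsum_le => q; rewrite mem_index_iota andbT => /andP[q2 _].
have q0 : (0 < q)%N by exact: ltnW.
have q0' := INR_gt0 q0.
have p0 := exp_pos (- (9 / 8) * ln (INR q)); rewrite -/(Rpower _ _) in p0.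
case: ifP => _; last by apply: Rlt_le; nra.
rewrite cycle_mean_scal.
apply: Rle_trans (Rmult_le_compat_l _ _ _ (ln_INR_ge0 q) (cycle_mean_Dq_pred q0 n0)) _.
have -> : Rpower (harmonic n / INR q) (5 / 4) = h * Rpower (INR q) (- (5 / 4)).
  rewrite /h /Rpower ln_div // -exp_plus; congr exp; ring.
have -> : Rpower (INR q) (- (9 / 8)) = Rpower (INR q) (- (5 / 4)) * Rpower (INR q) (1 / 8).
  by rewrite -Rpower_plus; congr Rpower; lra.
have : ln (INR q) <= 8 * Rpower (INR q) (1 / 8).
  have := @ln_le_sub1 (Rpower (INR q) (1 / 8)) (exp_pos _).
  by rewrite {1}/Rpower ln_exp; lra.
have := exp_pos (- (5 / 4) * ln (INR q)); rewrite -/(Rpower _ _) => p1 le.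
have : 0 < h * Rpower (INR q) (- (5 / 4)) by nra.
by nra.
Qed.

(** * From cycle lengths to independent summands *)

Lemma cycle_mean_abs_sub n F G c : (forall t, Rabs (F t - G t) <= c) ->
  Rabs (cycle_mean n F - cycle_mean n G) <= c.
Proof.
move=> FG; apply: Rabs_le.
have le1 : cycle_mean n F <= cycle_mean n (fun t => G t + c).
  apply: cycle_mean_le => t; have := FG t; have := Rle_abs (F t - G t); lra.
have le2 : cycle_mean n G <= cycle_mean n (fun t => F t + c).
  apply: cycle_mean_le => t; have := FG t; have := Rle_abs (- (F t - G t)).
  rewrite Rabs_Ropp; lra.
by rewrite !cycle_mean_add !cycle_mean_const in le1 le2; lra.
Qed.

Lemma sum_ln_symmetric (f : R -> R) : symmetric_seq (fun t => f (sum_ln t)).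
Proof. by move=> t u tu; rewrite /sum_ln (perm_big _ tu). Qed.

(** Equivalent to n! >= (n / e)^n. *)
Lemma sum_ln_ratio n : \rsum_(m < n) (ln (INR n) - ln (INR (n - m))) <= INR n.
Proof.
have -> : \rsum_(m < n) (ln (INR n) - ln (INR (n - m)))
  = INR n * ln (INR n) - \rsum_(m < n) ln (INR m.+1).
  rewrite rsum_sub rsum_ord_const; congr (_ - _).
  rewrite (reindex_inj rev_ord_inj) /=; apply: eq_bigr => i _.
  by rewrite subKn.
elim: n => [|n IHn]; first by rewrite big_ord0 /=; lra.
rewrite big_ord_recr [X in _ - X]/=.
case: n IHn => [|n] IHn; first by rewrite big_ord0 /= ln_1; lra.
have := @ln_INR_succ_le n.+1 isT; have p0 := @INR_gt0 n.+1 isT.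
move=> /(Rmult_le_compat_l _ _ _ (Rlt_le _ _ p0)); rewrite Rinv_r; last lra.
move: IHn; rewrite (S_INR n.+1); set S := \big[_/_]_(_ < _) _; nra.
Qed.

(* The mean of f(s + a * sum of xi_j ln j, j <= n) for independent xi_j with
   P(xi_j = 1) = 1/(j+1). *)
Fixpoint record_mean (f : R -> R) (a : R) (n : nat) (s : R) : R :=
  if n is m.+1 then
    (INR m.+1 * record_mean f a m s + record_mean f a m (s + a * ln (INR m.+1))) / INR m.+2
  else f s.

(** Brings [record_mean] into the shape of [cycle_mean_rec]: the term of index m models a uniform
    permutation of the m points left over, whose first cycle is counted as log m. *)
Lemma record_mean_sum f a n s :
  \rsum_(m < n.+1) record_mean f a m.-1 (s + a * ln (INR m)) = INR n.+1 * record_mean f a n s.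
Proof.
elim: n => [|n IHn].
  (* No point is left when m = 0, and the default [ln 0 = 0] makes the term equal to f s. *)
  rewrite big_ord_recl big_ord0 /= /ln; case: Rlt_dec => [/Rlt_irrefl//|_].
  by rewrite Rmult_0_r !Rplus_0_r Rmult_1_l.
rewrite big_ord_recr IHn [record_mean f a n.+1 s]/record_mean -/record_mean [LHS]/=.
rewrite -/(INR n.+1) [RHS]Rmult_comm /Rdiv Rmult_assoc Rinv_l ?Rmult_1_r //.
exact: not_0_INR.
Qed.

Section Comparison.
Variables (f : R -> R) (K a : R).
Hypotheses (K0 : 0 <= K) (a0 : 0 <= a).
Hypothesis lip : forall x y, Rabs (f x - f y) <= K * Rabs (x - y).

Let E n s := cycle_mean n (fun t => f (s + a * sum_ln t)).

Lemma cycle_mean_lipschitz n s s' : Rabs (E n s - E n s') <= K * Rabs (s - s').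
Proof.
apply: cycle_mean_abs_sub => t.
have -> : s - s' = (s + a * sum_ln t) - (s' + a * sum_ln t) by ring.
exact: lip.
Qed.

(* Replacing the length l of the first cycle, uniform on {1, .., n}, by n costs
   ln (n / l), which has mean at most 1; the costs accumulate to the mean number
   of cycles. *)
Lemma cycle_mean_record_mean n s :
  Rabs (E n s - record_mean f a n.-1 (s + a * ln (INR n))) <= a * K * harmonic n.
Proof.
elim/ltn_ind: n s => [[|n]] IHn s.
  rewrite /E /= /sum_ln big_nil /harmonic big_ord0 /ln; case: Rlt_dec => [/Rlt_irrefl//|_].
  by rewrite Rminus_diag Rabs_R0; lra.
set N := n.+1 in IHn *.
have p0 : 0 < INR N by exact: INR_gt0.
apply: (Rmult_le_reg_l (INR N)) => //.
rewrite -{1}(Rabs_pos_eq (INR N)); last exact: Rlt_le.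
rewrite -Rabs_mult Rmult_minus_distr_l {1}/E cycle_mean_rec; last first.
  exact: (sum_ln_symmetric (fun w => f (s + a * w))).
rewrite -record_mean_sum -rsum_sub.
apply: Rle_trans (rsum_abs _ _ _) _.
apply: (Rle_trans _ (\rsum_(m < N) (a * K * (ln (INR N) - ln (INR (N - m))) + a * K * harmonic m))).
  apply: (@rsum_ord_le N (fun m => Rabs (cycle_mean m (fun t => f (s + a * sum_ln ((N - m)%N :: t)))
     - record_mean f a m.-1 (s + a * ln (INR N) + a * ln (INR m))))
     (fun m => a * K * (ln (INR N) - ln (INR (N - m))) + a * K * harmonic m)) => m mN.
  have -> : cycle_mean m (fun t => f (s + a * sum_ln ((N - m)%N :: t)))
     = E m (s + a * ln (INR (N - m))).
    apply: cycle_mean_ext => t; rewrite /sum_ln big_cons; congr f; ring.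
  have := IHn m mN (s + a * ln (INR N)).
  have := cycle_mean_lipschitz m (s + a * ln (INR (N - m))) (s + a * ln (INR N)).
  have -> : s + a * ln (INR (N - m)) - (s + a * ln (INR N))
     = - (a * (ln (INR N) - ln (INR (N - m)))) by ring.
  have l0 : 0 <= a * (ln (INR N) - ln (INR (N - m))).
    by apply: Rmult_le_pos => //; have := ln_INR_le (leq_subr m N); lra.
  rewrite Rabs_Ropp (Rabs_pos_eq _ l0).
  set x := E m _; set y := E m _; set z := record_mean _ _ _ _ => le1 le2.
  have -> : x - z = (x - y) + (y - z) by ring.
  apply: Rle_trans (Rabs_triang _ _) _; lra.
rewrite big_split !rsum_scal harmonic_sum.
have aK : 0 <= a * K by exact: Rmult_le_pos.
have := Rmult_le_compat_l _ _ _ aK (sum_ln_ratio N); set S := \big[_/_]_(_ < _) _ => le.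
have -> : INR N * (a * K * harmonic N)
  = a * K * INR N + a * K * (INR N * harmonic N - INR N) by ring.
exact: Rplus_le_compat_r.
Qed.

End Comparison.

(** The mean of the sum of xi_j log j for k = 1; for k = 2 its variance with p (1 - p) replaced by
    p. *)
Definition record_sum k n : R := \rsum_(i < n) (ln (INR i.+1) ^ k / INR i.+2).

Lemma inv_succ_telescope n : (0 < n)%N ->
  / INR n - / INR n.+1 = / (INR n * INR n.+1).
Proof.
by move=> n0; have p0 := INR_gt0 n0; rewrite S_INR; field; lra.
Qed.

(** Comparison with the increments of log^(k+1) / (k+1); the errors c / (n (n + 1)) telescope to at
    most c. *)
Lemma record_sum_bound k N (c : R) : 0 <= c ->
  (forall n, (0 < n < N)%N ->
     0 <= ln (INR n.+1) ^ k.+1 / INR k.+1 - ln (INR n) ^ k.+1 / INR k.+1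
          - ln (INR n) ^ k / INR n.+1 <= c * / (INR n * INR n.+1)) ->
  (0 < N)%N ->
  0 <= ln (INR N) ^ k.+1 / INR k.+1 - record_sum k N.-1 <= c.
Proof.
move=> c0 step N0.
suff H n : (n < N)%N ->
  0 <= ln (INR n.+1) ^ k.+1 / INR k.+1 - record_sum k n <= c * (1 - / INR n.+1).
  have := H N.-1; rewrite prednK // leqnn => /(_ isT).
  by have := inv_INR_ge0 N; nra.
elim: n => [|n IHn] nN.
  rewrite /record_sum big_ord0 ln_1 pow_ne_zero // /= Rinv_1; lra.
have := IHn (ltnW nN); have := step n.+1 nN.
rewrite -inv_succ_telescope //.
have -> : record_sum k n.+1 = record_sum k n + ln (INR n.+1) ^ k / INR n.+2.
  by rewrite /record_sum big_ord_recr.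
lra.
Qed.

Section StepBounds.
Variable n : nat.
Hypothesis n0 : (0 < n)%N.
Let x := ln (INR n).
Let d := ln (INR n.+1) - ln (INR n).
Let r := / INR n.
Let q := / (INR n * INR n.+1).

(** Errors are to be measured in the telescoping unit q: the increment d of the logarithm exceeds 1
    / (n + 1) by at most q, and d^2 is at most 2 q. *)
Lemma record_step_facts :
  [/\ 0 <= x, / INR n.+1 <= d <= r, 0 <= / INR n.+1 /\ r - / INR n.+1 = q, 0 < r <= 1 & r * r <= 2 * q].
Proof.
have p0 := INR_gt0 n0; have p1 : 1 <= INR n by have := INR_leq n0.
split; first exact: ln_INR_ge0.
- by split; [exact: ln_INR_succ_ge | exact: ln_INR_succ_le].
- by split; [exact: inv_INR_ge0 | exact: inv_succ_telescope].
- split; first exact: Rinv_0_lt_compat.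
  by rewrite /r -Rinv_1; apply: Rinv_le_contravar; lra.
rewrite /r /q -Rinv_mult S_INR.
have -> : 2 * / (INR n * (INR n + 1)) = / (INR n * (INR n + 1) / 2) by field; lra.
by apply: Rinv_le_contravar; nra.
Qed.
End StepBounds.

Lemma record_sum1 N : (0 < N)%N ->
  0 <= ln (INR N) ^ 2 / 2 - record_sum 1 N.-1 <= ln (INR N) + 1.
Proof.
move=> N0; have L0 := ln_INR_ge0 N.
have -> : 2 = INR 2 by rewrite /=; ring.
apply: record_sum_bound => //; first lra.
move=> n /andP[n0 nN]; have := record_step_facts n0.
have xL := ln_INR_le (ltnW nN).
set x := ln (INR n) in xL *; set y := ln (INR n.+1).
set q := / (_ * _); set r := / INR n; set r1 := / INR n.+1.
case=> x0 [d1 d2] [r10 rq] [r0 r1'] rr.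
have -> : y ^ 2 / INR 2 - x ^ 2 / INR 2 - x ^ 1 / INR n.+1
  = (y - x) * x + (y - x) * (y - x) / 2 - x * r1.
  by rewrite /r1 [INR 2]/=; field; apply: not_0_INR.
move: d1 d2; set d := y - x => d1 d2.
have q0 : 0 <= q by nra.
have dd : d * d <= r * r by nra.
split; nra.
Qed.

Lemma record_sum2 N : (0 < N)%N ->
  0 <= ln (INR N) ^ 3 / 3 - record_sum 2 N.-1 <= (ln (INR N) + 1) ^ 2.
Proof.
move=> N0; have L0 := ln_INR_ge0 N.
have -> : 3 = INR 3 by rewrite /=; ring.
apply: record_sum_bound => //; first nra.
move=> n /andP[n0 nN]; have := record_step_facts n0.
have xL := ln_INR_le (ltnW nN).
set x := ln (INR n) in xL *; set y := ln (INR n.+1).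
set q := / (_ * _); set r := / INR n; set r1 := / INR n.+1.
case=> x0 [d1 d2] [r10 rq] [r0 r1'] rr.
have -> : y ^ 3 / INR 3 - x ^ 3 / INR 3 - x ^ 2 / INR n.+1
  = (y - x) * (x * x) + (y - x) * (y - x) * x + (y - x) * (y - x) * (y - x) / 3 - x * x * r1.
  by rewrite /r1 [INR 3]/=; field; apply: not_0_INR.
move: d1 d2; set d := y - x => d1 d2.
have d0 : 0 <= d by lra.
have q0 : 0 <= q by nra.
have dd : d * d <= 2 * q by apply: Rle_trans rr; nra.
have dd0 : 0 <= d * d by nra.
have ddd : d * d * d <= 2 * q by nra.
have ddd0 : 0 <= d * d * d by nra.
have t1 : d * (x * x) <= r * (x * x) by nra.
have t1' : r1 * (x * x) <= d * (x * x) by nra.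
have t2 : d * d * x <= 2 * q * x by nra.
have t2' : 0 <= d * d * x by nra.
split; first nra.
apply: (Rle_trans _ ((x + 1) ^ 2 * q)); last by apply: Rmult_le_compat_r => //; nra.
nra.
Qed.

Lemma sum_inv_sqr n : \rsum_(i < n) (/ INR i.+2) ^ 2 <= 1.
Proof.
suff : \rsum_(i < n) (/ INR i.+2) ^ 2 <= 1 - / INR n.+1.
  by have := inv_INR_ge0 n.+1; lra.
elim: n => [|n IHn]; first by rewrite big_ord0 /= Rinv_1; lra.
have [_ _ [_ e] [r0 _] _] := @record_step_facts n.+1 isT.
have r1 := inv_INR_ge0 n.+2.
have rr : / INR n.+2 <= / INR n.+1.
  by apply: Rinv_le_contravar; [exact: INR_gt0 | exact: INR_leq].
rewrite big_ord_recr; move: IHn e r1 rr; rewrite Rinv_mult.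
set S := \big[_/_]_(_ < n) _; set x := / INR n.+1; set y := / INR n.+2.
by move=> IHn e y0 yx; change (S + y ^ 2 <= 1 - y); nra.
Qed.

(** * The Gaussian integral *)

Definition gauss (t : R) : R := exp (- (t ^ 2) / 2).

Lemma gauss_continuous t : continuous gauss t.
Proof. by apply: ex_derive_continuous; rewrite /gauss; auto_derive. Qed.

Lemma ex_RInt_gauss a b : ex_RInt gauss a b.
Proof. by apply: ex_RInt_continuous => t _; exact: gauss_continuous. Qed.

Definition gauss_int x := RInt gauss 0 x.

Lemma is_derive_gauss_int x : is_derive gauss_int x (gauss x).
Proof.
apply: (is_derive_RInt _ _ 0).
  by apply: filter_forall => y; apply: RInt_correct; exact: ex_RInt_gauss.
exact: gauss_continuous.
Qed.

Lemma gauss_le1 t : gauss t <= 1.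
Proof.
rewrite /gauss -exp_0; have : - t ^ 2 / 2 <= 0 by nra.
by case=> [/exp_increasing/Rlt_le|->] //; exact: Rle_refl.
Qed.

Lemma gauss_gt0 t : 0 < gauss t.
Proof. exact: exp_pos. Qed.

Lemma gauss_even t : gauss (- t) = gauss t.
Proof. by rewrite /gauss; congr exp; field. Qed.

(* gauss_int ^ 2 / 2 + polar_int is constant: the classical evaluation of the
   Gaussian integral by differentiating under the integral sign. *)
Definition polar_kernel (x t : R) : R := exp (- (x ^ 2 * (1 + t ^ 2)) / 2) / (1 + t ^ 2).
Definition polar_int x := RInt (polar_kernel x) 0 1.

Lemma onept2_gt0 t : 0 < 1 + t ^ 2. Proof. nra. Qed.

Lemma polar_kernel_derive x t :
  is_derive (fun y => polar_kernel y t) x (- x * exp (- (x ^ 2 * (1 + t ^ 2)) / 2)).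
Proof.
have p := onept2_gt0 t; rewrite /polar_kernel; auto_derive => //.
rewrite /= /Rdiv; field; nra.
Qed.

Lemma polar_kernel_continuous x t : continuous (polar_kernel x) t.
Proof.
have p := onept2_gt0 t; apply: ex_derive_continuous; rewrite /polar_kernel; auto_derive.
lra.
Qed.

Lemma ex_RInt_polar x : ex_RInt (polar_kernel x) 0 1.
Proof. by apply: ex_RInt_continuous => t _; exact: polar_kernel_continuous. Qed.

Lemma gauss_int_scale x : RInt (fun t => x * gauss (x * t)) 0 1 = gauss_int x.
Proof.
rewrite /gauss_int.
have := @RInt_comp_lin _ gauss x 0 0 1.
rewrite Rmult_0_r Rmult_1_r !Rplus_0_r => <-; last exact: ex_RInt_gauss.
by apply: RInt_ext => t _; rewrite Rplus_0_r.
Qed.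

Lemma is_derive_polar_int x : is_derive polar_int x (- (gauss x * gauss_int x)).
Proof.
have <- : RInt (fun t => Derive (fun y => polar_kernel y t) x) 0 1
   = - (gauss x * gauss_int x).
  rewrite -gauss_int_scale.
  transitivity (RInt (fun t => scal (- gauss x) (x * gauss (x * t))) 0 1).
    apply: RInt_ext => t _; rewrite (is_derive_unique _ _ _ (polar_kernel_derive x t)).
    rewrite /scal /= /mult /= /gauss.
    have -> : - (x ^ 2 * (1 + t ^ 2)) / 2 = - x ^ 2 / 2 + - (x * t) ^ 2 / 2 by field.
    rewrite exp_plus; ring.
  rewrite RInt_scal; first by rewrite /scal /= /mult /=; ring.
  apply: ex_RInt_continuous => t _; apply: ex_derive_continuous.
  by rewrite /gauss; auto_derive.
apply: is_derive_RInt_param.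
- apply: filter_forall => y t _; eexists; exact: polar_kernel_derive.
- move=> t _.
  apply: (continuity_2d_pt_ext (fun u v => - u * exp (- (u ^ 2 * (1 + v ^ 2)) / 2))).
    by move=> u v; rewrite (is_derive_unique _ _ _ (polar_kernel_derive u v)).
  apply: continuity_2d_pt_mult.
    by apply: continuity_2d_pt_opp; exact: continuity_2d_pt_id1.
  apply: (@continuity_1d_2d_pt_comp exp (fun u v => - (u ^ 2 * (1 + v ^ 2)) / 2)).
    by apply: derivable_continuous_pt; exact: derivable_pt_exp.
  apply: (continuity_2d_pt_ext (fun u v => (- / 2) * ((u * u) * (1 + v * v)))).
    by move=> u v; field.
  apply: continuity_2d_pt_mult; first exact: continuity_2d_pt_const.
  apply: continuity_2d_pt_mult.
    by apply: continuity_2d_pt_mult; exact: continuity_2d_pt_id1.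
  apply: continuity_2d_pt_plus; first exact: continuity_2d_pt_const.
  by apply: continuity_2d_pt_mult; exact: continuity_2d_pt_id2.
apply: filter_forall => y; exact: ex_RInt_polar.
Qed.

Lemma polar_int0 : polar_int 0 = PI / 4.
Proof.
rewrite /polar_int.
transitivity (RInt (fun t => / (1 + t ^ 2)) 0 1).
  apply: RInt_ext => t _; rewrite /polar_kernel.
  have -> : - (0 ^ 2 * (1 + t ^ 2)) / 2 = 0 by field.
  by rewrite exp_0 /Rdiv Rmult_1_l.
have -> : PI / 4 = minus (atan 1) (atan 0).
  by rewrite atan_0 atan_1 /minus /plus /opp /=; ring.
apply: is_RInt_unique; apply: is_RInt_derive => t _.
  exact/is_derive_Reals/derivable_pt_lim_atan.
apply: ex_derive_continuous; auto_derive; have := onept2_gt0 t; lra.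
Qed.

Lemma gauss_int_sqr x : gauss_int x ^ 2 / 2 + polar_int x = PI / 4.
Proof.
have D y : is_derive (fun y => gauss_int y ^ 2 / 2 + polar_int y) y 0.
  have d1 := is_derive_gauss_int y; have d2 := is_derive_polar_int y.
  evar_last; first (apply: is_derive_plus; [apply: is_derive_ext|exact: d2]).
  - by move=> t; instantiate (1 := fun t => / 2 * (gauss_int t * gauss_int t)); rewrite /=; field.
  - apply: is_derive_scal; apply: is_derive_mult; [exact: d1|exact: d1|].
    by move=> *; exact: Rmult_comm.
  by rewrite /plus /mult /=; field.
have -> : PI / 4 = gauss_int 0 ^ 2 / 2 + polar_int 0.
  rewrite polar_int0 /gauss_int RInt_point /zero /=; field.
have [y [_ e]] : exists y, Rmin 0 x <= y <= Rmax 0 x /\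
   (gauss_int x ^ 2 / 2 + polar_int x) - (gauss_int 0 ^ 2 / 2 + polar_int 0) = 0 * (x - 0).
  apply: (MVT_gen (fun y => gauss_int y ^ 2 / 2 + polar_int y) 0 x (fun=> 0)) => y _.
    exact: D.
  apply/continuity_pt_filterlim; apply: (@ex_derive_continuous R_AbsRing R_NormedModule).
  by eexists; exact: D.
lra.
Qed.

Lemma polar_int_bound x : 0 <= polar_int x <= gauss x.
Proof.
have k0 t : 0 <= polar_kernel x t <= gauss x.
  have p := onept2_gt0 t; rewrite /polar_kernel; split.
    by apply: Rlt_le; apply: Rdiv_lt_0_compat => //; exact: exp_pos.
  have -> : - (x ^ 2 * (1 + t ^ 2)) / 2 = - x ^ 2 / 2 + - (x * t) ^ 2 / 2 by field.
  rewrite exp_plus -/(gauss x) -/(gauss (x * t)).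
  apply: (Rmult_le_reg_r (1 + t ^ 2)) => //.
  have -> : gauss x * gauss (x * t) / (1 + t ^ 2) * (1 + t ^ 2) = gauss x * gauss (x * t).
    by field; lra.
  apply: Rmult_le_compat_l; first exact/Rlt_le/gauss_gt0.
  by have := gauss_le1 (x * t); nra.
split.
  by apply: RInt_ge_0; [lra | exact: ex_RInt_polar | move=> t _; have [] := k0 t].
apply: (Rle_trans _ (RInt (fun=> gauss x) 0 1)); last first.
  by rewrite RInt_const /scal /= /mult /=; lra.
apply: RInt_le; [lra | exact: ex_RInt_polar | exact: ex_RInt_const |].
by move=> t _; have [] := k0 t.
Qed.

Lemma gauss_int_opp x : gauss_int (- x) = - gauss_int x.
Proof.
rewrite -!gauss_int_scale -[RHS]/(opp (RInt (fun t => x * gauss (x * t)) 0 1)) -RInt_opp.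
  apply: RInt_ext => t _; rewrite (_ : - x * t = - (x * t)); last ring.
  by rewrite gauss_even /opp /=; ring.
apply: ex_RInt_continuous => t _; apply: ex_derive_continuous.
by rewrite /gauss; auto_derive.
Qed.

Lemma gauss_int_ge0 x : 0 <= x -> 0 <= gauss_int x.
Proof.
move=> x0; apply: RInt_ge_0 => //; first exact: ex_RInt_gauss.
by move=> t _; exact/Rlt_le/gauss_gt0.
Qed.

(** With s = sqrt (PI / 2), [gauss_int_sqr] reads (s - I) (s + I) = 2 * [polar_int x], where s + I
    >= 1 and [polar_int] is below the Gaussian. An algebraic tail is enough here. *)
Lemma gauss_int_tail x : 0 <= x ->
  0 <= sqrt (PI / 2) - gauss_int x <= 2 * / (1 + x ^ 2 / 2).
Proof.
move=> x0; have I0 := gauss_int_ge0 x0; have e := gauss_int_sqr x.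
have [p0 p1] := polar_int_bound x.
have s1 : 1 <= sqrt (PI / 2).
  by rewrite -{1}sqrt_1; apply: sqrt_le_1_alt; have := PI2_1; lra.
have ss : sqrt (PI / 2) * sqrt (PI / 2) = PI / 2.
  by apply: sqrt_sqrt; have := PI_RGT_0; lra.
have g1 : gauss x <= / (1 + x ^ 2 / 2).
  have -> : gauss x = / exp (x ^ 2 / 2) by rewrite -exp_Ropp; congr exp; field.
  apply: Rinv_le_contravar; first nra.
  exact: exp_ineq1_le.
set s := sqrt _ in s1 ss *; set I := gauss_int x in I0 e *.
have d : (s - I) * (s + I) = 2 * polar_int x.
  have -> : (s - I) * (s + I) = s * s - I ^ 2 by ring.
  lra.
have sI : 1 <= s + I by lra.
have s0 : 0 <= s - I by apply: (Rmult_le_reg_r (s + I)); lra.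
split=> //; nra.
Qed.

(** * The normal distribution function *)

Definition gauss_cst := / sqrt (2 * PI).

Lemma gauss_cst_bound : 0 < gauss_cst <= / 2.
Proof.
have p := PI2_1; have s2 : 2 <= sqrt (2 * PI).
  have e : sqrt (2 * 2) = 2 by apply: sqrt_square; lra.
  rewrite -[X in X <= _]e; apply: sqrt_le_1_alt; lra.
split; first by apply: Rinv_0_lt_compat; lra.
by apply: Rinv_le_contravar; lra.
Qed.

Lemma gauss_cst_half : gauss_cst * sqrt (PI / 2) = / 2.
Proof.
have p := PI_RGT_0; rewrite /gauss_cst.
have s0 : 0 < sqrt (2 * PI) by apply: sqrt_lt_R0; lra.
have t0 : 0 < sqrt (PI / 2) by apply: sqrt_lt_R0; lra.
have ss : sqrt (2 * PI) * sqrt (2 * PI) = 2 * PI by apply: sqrt_sqrt; lra.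
have tt : sqrt (PI / 2) * sqrt (PI / 2) = PI / 2 by apply: sqrt_sqrt; lra.
move: s0 t0 ss tt; set s := sqrt _; set t := sqrt _ => s0 t0 ss tt.
have e : (s - 2 * t) * (s + 2 * t) = 0.
  have -> : (s - 2 * t) * (s + 2 * t) = s * s - 4 * (t * t) by ring.
  lra.
have -> : s = 2 * t by case: (Rmult_integral _ _ e); lra.
by field; lra.
Qed.

(** Based at 0 to keep improper integrals out of the calculus; [Phi_normal_cdf] identifies it with
    [Phi]. *)
Definition normal_cdf x := / 2 + gauss_cst * gauss_int x.

Lemma is_derive_normal_cdf x : is_derive normal_cdf x (gauss_cst * gauss x).
Proof.
rewrite /normal_cdf; evar_last; first apply: is_derive_plus.
- exact: is_derive_const.
- by apply: is_derive_scal; exact: is_derive_gauss_int.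
by rewrite /plus /zero /=; ring.
Qed.

Lemma normal_cdf_opp x : normal_cdf (- x) = 1 - normal_cdf x.
Proof. by rewrite /normal_cdf gauss_int_opp; lra. Qed.

Lemma normal_cdf_tail x : 0 <= x ->
  1 - / (1 + x ^ 2 / 2) <= normal_cdf x <= 1.
Proof.
move=> x0; have [t0 t1] := gauss_int_tail x0; have [k0 k1] := gauss_cst_bound.
have e := gauss_cst_half; rewrite /normal_cdf.
have : 0 < / (1 + x ^ 2 / 2) by apply: Rinv_0_lt_compat; nra.
move: t0 t1; set u := / (_ + _); set s := sqrt _ in e *; set I := gauss_int x; nra.
Qed.

Lemma lipschitz_of_derive (f f' : R -> R) (a b C : R) : a <= b ->
  (forall x, a <= x <= b -> is_derive f x (f' x)) ->
  (forall x, a <= x <= b -> Rabs (f' x) <= C) ->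
  Rabs (f b - f a) <= C * (b - a).
Proof.
move=> ab D B.
have [c [cab ->]] : exists c, Rmin a b <= c <= Rmax a b /\ f b - f a = f' c * (b - a).
  apply: MVT_gen => x; rewrite Rmin_left // Rmax_right // => xab.
    by apply: D; lra.
  apply/continuity_pt_filterlim/ex_derive_continuous; eexists; exact: D.
rewrite Rmin_left // Rmax_right // in cab.
rewrite Rabs_mult (Rabs_pos_eq (b - a)); last lra.
by apply: Rmult_le_compat_r; [lra | exact: B].
Qed.

Lemma normal_cdf_derive_bound x : 0 <= gauss_cst * gauss x <= 1.
Proof.
have [k0 k1] := gauss_cst_bound; have g0 := gauss_gt0 x; have g1 := gauss_le1 x.
by split; nra.
Qed.

Lemma normal_cdf_lipschitz x y : Rabs (normal_cdf x - normal_cdf y) <= Rabs (x - y).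
Proof.
have H u v : u <= v -> Rabs (normal_cdf v - normal_cdf u) <= Rabs (v - u).
  move=> uv; rewrite (Rabs_pos_eq (v - u)); last lra.
  rewrite -[X in _ <= X]Rmult_1_l.
  apply: (@lipschitz_of_derive normal_cdf (fun z => gauss_cst * gauss z)) => // z _.
    exact: is_derive_normal_cdf.
  by rewrite Rabs_pos_eq; have := normal_cdf_derive_bound z; lra.
case: (Rle_dec x y) => xy; last by apply: H; lra.
by rewrite Rabs_minus_sym (Rabs_minus_sym x); exact: H.
Qed.

Lemma normal_cdf_le x y : x <= y -> normal_cdf x <= normal_cdf y.
Proof.
move=> xy; have [c [_ e]] : exists c, Rmin x y <= c <= Rmax x y /\
   normal_cdf y - normal_cdf x = (gauss_cst * gauss c) * (y - x).
  apply: (MVT_gen normal_cdf x y (fun c => gauss_cst * gauss c)) => z _.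
    exact: is_derive_normal_cdf.
  apply/continuity_pt_filterlim/ex_derive_continuous; eexists; exact: is_derive_normal_cdf.
have := normal_cdf_derive_bound c; nra.
Qed.

Lemma normal_cdf_bound x : 0 <= normal_cdf x <= 1.
Proof.
have H y : 0 <= y -> / 2 <= normal_cdf y <= 1.
  move=> y0; have [_ ?] := normal_cdf_tail y0; split=> //.
  have := gauss_int_ge0 y0; have [k0 _] := gauss_cst_bound; rewrite /normal_cdf; nra.
case: (Rle_dec 0 x) => x0; first by have := H x x0; lra.
have := @H (- x); rewrite normal_cdf_opp; lra.
Qed.

Lemma Phi_normal_cdf x : Phi x = normal_cdf x.
Proof.
rewrite /Phi -/gauss_cst.
have lim_gi : filterlim gauss_int (Rbar_locally m_infty) (locally (- sqrt (PI / 2))).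
  apply/filterlim_locally => eps.
  exists (- (2 / eps + 2)) => y yM.
  have e0 := cond_pos eps; have ie : 0 < 2 / eps by apply: Rdiv_lt_0_compat; lra.
  have y0 : 0 <= - y by lra.
  have [t0 t1] := gauss_int_tail y0.
  rewrite gauss_int_opp in t0 t1.
  rewrite /ball /= /AbsRing_ball /abs /= /minus /plus /opp /=.
  apply: Rle_lt_trans (_ : 2 * / (1 + (- y) ^ 2 / 2) < eps).
    by apply: Rabs_le; lra.
  have -> : pos eps = 2 * / (2 / eps) by field; lra.
  apply: Rmult_lt_compat_l; first lra.
  apply: Rinv_lt_contravar; nra.
have D : forall t, Derive gauss_int t = gauss t.
  by move=> t; apply: is_derive_unique; exact: is_derive_gauss_int.
have -> : normal_cdf x = gauss_cst * (gauss_int x - (- sqrt (PI / 2))).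
  by rewrite /normal_cdf -gauss_cst_half; ring.
suff H : is_RInt_gen gauss (Rbar_locally m_infty) (at_point x) (gauss_int x - - sqrt (PI / 2)).
  rewrite -(is_RInt_gen_unique gauss _ H); reflexivity.
apply: (is_RInt_gen_ext (Derive gauss_int)).
  by apply: filter_forall => ab y _; exact: D.
apply: is_RInt_gen_Derive => //.
- apply: filter_forall => ab y _; eexists; exact: is_derive_gauss_int.
- apply: filter_forall => ab y _; apply: (continuous_ext gauss) => [t|]; first by rewrite D.
  exact: gauss_continuous.
by apply/filterlim_locally => eps; exact: ball_center.
Qed.

(** * The heat flow *)

(* heat v y is, up to a constant, the N(0, v) density at y; the suffixes record
   derivatives in y and v. The heat equation is heat_v = heat_yy / 2. *)
Definition heat v y := exp (- (y ^ 2 / (2 * v))) / sqrt v.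
Definition heat_y v y := - (y / v) * heat v y.
Definition heat_yy v y := (y ^ 2 / v - 1) / v * heat v y.
Definition heat_yv v y := y * (3 / 2 - y ^ 2 / (2 * v)) / v ^ 2 * heat v y.

Lemma is_derive_heat_y v y : 0 < v -> is_derive (heat v) y (heat_y v y).
Proof.
move=> v0; have s0 := sqrt_lt_R0 _ v0; rewrite /heat_y /heat; auto_derive; first lra.
by rewrite /= /Rdiv; field; lra.
Qed.

Lemma is_derive_heat_yy v y : 0 < v -> is_derive (heat_y v) y (heat_yy v y).
Proof.
move=> v0; have s0 := sqrt_lt_R0 _ v0; rewrite /heat_y /heat_yy /heat; auto_derive; first lra.
by rewrite /= /Rdiv; field; lra.
Qed.

Lemma is_derive_heat_v v y : 0 < v -> is_derive (fun u => heat u y) v (heat_yy v y / 2).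
Proof.
move=> v0; have s0 := sqrt_lt_R0 _ v0; have ss := sqrt_sqrt v (Rlt_le _ _ v0).
rewrite /heat_yy /heat; auto_derive; first by split; [lra | split; [lra | split; lra]].
rewrite /= /Rdiv; move: s0 ss; set s := sqrt v => s0 ss.
rewrite -ss; field; lra.
Qed.

Lemma is_derive_heat_yv v y : 0 < v -> is_derive (fun u => heat_y u y) v (heat_yv v y).
Proof.
move=> v0; have s0 := sqrt_lt_R0 _ v0; have ss := sqrt_sqrt v (Rlt_le _ _ v0).
rewrite /heat_y /heat_yv /heat; auto_derive; first by repeat split; lra.
rewrite /= /Rdiv; move: s0 ss; set s := sqrt v => s0 ss.
rewrite -ss; field; lra.
Qed.

(* With S = y^2 / v the Gaussian factor is exp (- S / 2). *)
Lemma exp_poly_bounds S : 0 <= S ->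
  [/\ exp (- (S / 2)) <= 1, S * exp (- (S / 2)) <= 2 & S ^ 2 * exp (- (S / 2)) <= 16].
Proof.
move=> S0; have e0 := exp_pos (S / 2); rewrite exp_Ropp.
have e1 := exp_ineq1_le (S / 2).
have e4 := exp_ineq1_le (S / 4).
have ee : exp (S / 2) = exp (S / 4) * exp (S / 4) by rewrite -exp_plus; congr exp; field.
have i0 := Rinv_0_lt_compat _ e0.
have ie : / exp (S / 2) * exp (S / 2) = 1 by field; lra.
have le c x : x <= c * exp (S / 2) -> x * / exp (S / 2) <= c.
  move=> le; have := Rmult_le_compat_r _ _ _ (Rlt_le _ _ i0) le.
  by rewrite Rmult_assoc (Rmult_comm (exp _)) ie; lra.
split; first by rewrite -[X in X <= _]Rmult_1_l; apply: le; lra.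
- by apply: le; lra.
apply: le; rewrite ee; set E := exp (S / 4) in e4 *; nra.
Qed.

Section HeatBounds.
Variable v0 : R.
Hypothesis v0_gt0 : 0 < v0.

Let w := Rmin v0 1.

(** One constant for three derivatives: the powers of 1 / v and 1 / sqrt v that occur are at most
    w^(-3) with w = min (v0, 1), and the factor depending on y / sqrt v is at most 16. *)
Definition heat_const := 16 / (Rmin v0 1) ^ 3.

Let w0 : 0 < w. Proof. by apply: Rmin_glb_lt; lra. Qed.
Let w1 : w <= 1. Proof. exact: Rmin_r. Qed.

Lemma heat_bounds v y : v0 <= v ->
  [/\ Rabs (heat_y v y) <= heat_const, Rabs (heat_yy v y) <= heat_const
    & Rabs (heat_yv v y) <= heat_const].
Proof.
move=> vv; have v_gt0 : 0 < v by lra.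
have wv : w <= v by have := Rmin_l v0 1; rewrite -/w; lra.
have s0 := sqrt_lt_R0 _ v_gt0; have ss := sqrt_sqrt v (Rlt_le _ _ v_gt0).
have ws : w <= sqrt v.
  have : w * w <= v by nra.
  by move=> ww; apply: (Rsqr_incr_0_var); rewrite /Rsqr; lra.
set s := sqrt v in s0 ss ws *.
pose z := y / s; pose e := exp (- (z ^ 2 / 2)).
have z2 : 0 <= z ^ 2 by nra.
have [e1 e2 e4] := exp_poly_bounds z2; rewrite -/e in e1 e2 e4.
have e0 : 0 < e by exact: exp_pos.
have yE : y = z * s by rewrite /z; field; lra.
have hE : heat v y = e / s.
  rewrite /heat /e -/s; congr (exp (- _) / _); rewrite yE -ss; field; lra.
have iw : 0 < / w by exact: Rinv_0_lt_compat.
have iw1 : 1 <= / w by rewrite -Rinv_1; apply: Rinv_le_contravar; lra.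
have is_ : 0 < / s <= / w by split; [exact: Rinv_0_lt_compat | exact: Rinv_le_contravar].
have iv : 0 < / v <= / w by split; [exact: Rinv_0_lt_compat | exact: Rinv_le_contravar].
have KE : heat_const = 16 * (/ w * / w * / w) by rewrite /heat_const -/w; field; lra.
have Kw x c : 0 <= c <= / w * / w * / w -> Rabs x <= 16 -> Rabs (x * c) <= heat_const.
  move=> [c0 c1] x16; rewrite Rabs_mult (Rabs_pos_eq c) // KE.
  by apply: Rmult_le_compat => //; exact: Rabs_pos.
have sv : 0 <= / s * / v <= / w * / w * / w.
  split; first nra.
  apply: (Rle_trans _ (/ w * / w)); last nra.
  apply: Rmult_le_compat; lra.
have vv1 : 0 <= / v * / v <= / w * / w * / w.
  split; first nra.
  apply: (Rle_trans _ (/ w * / w)); last nra.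
  apply: Rmult_le_compat; lra.
have v1 : 0 <= / v <= / w * / w * / w by split; nra.
(* Odd powers of |z| are bounded by the mean of the two neighbouring even powers. *)
have aze : Rabs z * e <= 3 / 2.
  have : Rabs z ^ 2 = z ^ 2 by rewrite pow2_abs.
  have := Rabs_pos z; nra.
have a3 : Rabs z ^ 3 * e <= 9.
  have zz : Rabs z ^ 2 = z ^ 2 by rewrite pow2_abs.
  have : Rabs z ^ 3 <= (z ^ 2 + (z ^ 2) ^ 2) / 2.
    rewrite -zz; have p := Rabs_pos z; have := pow2_ge_0 (Rabs z * (Rabs z - 1)); nra.
  nra.
have E1 : heat_y v y = (- (z * e)) * / v.
  by rewrite /heat_y hE yE -ss; field; lra.
have E2 : heat_yy v y = ((z ^ 2 - 1) * e) * (/ s * / v).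
  by rewrite /heat_yy hE yE -ss; field; lra.
have E3 : heat_yv v y = (z * (3 / 2 - z ^ 2 / 2) * e) * (/ v * / v).
  by rewrite /heat_yv hE yE -ss; field; lra.
clearbody e; clearbody z; split.
- rewrite E1; apply: Kw => //.
  by rewrite Rabs_Ropp Rabs_mult (Rabs_pos_eq e); lra.
- rewrite E2; apply: Kw => //; apply: Rabs_le; nra.
rewrite E3; apply: Kw => //.
rewrite !Rabs_mult (Rabs_pos_eq e); last lra.
have t : Rabs (3 / 2 - z ^ 2 / 2) <= 3 / 2 + z ^ 2 / 2 by apply: Rabs_le; lra.
have p := Rabs_pos z.
apply: (Rle_trans _ (Rabs z * (3 / 2 + z ^ 2 / 2) * e)).
  apply: Rmult_le_compat_r; first lra.
  exact: Rmult_le_compat_l.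
have -> : Rabs z * (3 / 2 + z ^ 2 / 2) * e = 3 / 2 * (Rabs z * e) + (Rabs z ^ 3 * e) / 2.
  by rewrite -(pow2_abs z); field.
lra.
Qed.

Let K := heat_const.

Lemma heat_const_gt0 : 0 < K.
Proof. by apply: Rdiv_lt_0_compat; [lra | apply: pow_lt]. Qed.

Lemma heat_y_lipschitz v x y : v0 <= v -> Rabs (heat_y v x - heat_y v y) <= K * Rabs (x - y).
Proof.
move=> vv; have H a b : a <= b -> Rabs (heat_y v b - heat_y v a) <= K * Rabs (b - a).
  move=> ab; rewrite (Rabs_pos_eq (b - a)); last lra.
  apply: (lipschitz_of_derive ab) => z _; first by apply: is_derive_heat_yy; lra.
  by have [] := heat_bounds z vv.
case: (Rle_dec x y) => xy; last by apply: H; lra.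
by rewrite Rabs_minus_sym (Rabs_minus_sym x); exact: H.
Qed.

Lemma heat_taylor v z h : v0 <= v -> 0 <= h ->
  Rabs (heat v (z - h) - heat v z + h * heat_y v z) <= K * h * h.
Proof.
move=> vv h0; have := @lipschitz_of_derive (fun t => heat v (z - t) + t * heat_y v z)
   (fun t => - heat_y v (z - t) + heat_y v z) 0 h (K * h) h0.
rewrite /= Rminus_0_r Rmult_0_l Rplus_0_r Rminus_0_r.
have -> : heat v (z - h) + h * heat_y v z - heat v z = heat v (z - h) - heat v z + h * heat_y v z.
  by ring.
apply => t th.
  evar_last; first apply: is_derive_plus.
  - apply: (is_derive_comp (heat v)); first by apply: is_derive_heat_y; lra.
    by auto_derive.
  - by auto_derive.
  by rewrite /plus /scal /= /mult /=; ring.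
have -> : - heat_y v (z - t) + heat_y v z = heat_y v z - heat_y v (z - t) by ring.
apply: Rle_trans (heat_y_lipschitz _ _ vv) _.
have -> : z - (z - t) = t by ring.
rewrite Rabs_pos_eq; last lra.
by have := heat_const_gt0; nra.
Qed.

Lemma heat_time v u z : v0 <= v -> v <= u ->
  Rabs (heat u z - heat v z) <= K * (u - v) /\ Rabs (heat_y u z - heat_y v z) <= K * (u - v).
Proof.
move=> vv vu; split.
  apply: (@lipschitz_of_derive (fun t => heat t z) (fun t => heat_yy t z / 2)) => // t tvu.
    by apply: is_derive_heat_v; lra.
  have [_ b _] := @heat_bounds t z (Rle_trans _ _ _ vv (proj1 tvu)).
  rewrite /Rdiv Rabs_mult (Rabs_pos_eq (/ 2)); last lra.
  by have := Rabs_pos (heat_yy t z); rewrite -/K in b; lra.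
apply: (@lipschitz_of_derive (fun t => heat_y t z) (fun t => heat_yv t z)) => // t tvu.
  by apply: is_derive_heat_yv; lra.
by have [] := @heat_bounds t z (Rle_trans _ _ _ vv (proj1 tvu)).
Qed.

(** Up to the factor - [gauss_cst] * p this is the derivative in b of the error in [heat_step].
    Taylor at z = y - p b with increment (1 - p) b costs b^2, the change of time p b^2, and the rest
    of the first-order term p b. *)
Lemma heat_bracket v p b y : v0 <= v -> 0 <= p <= 1 -> 0 <= b <= 1 ->
  Rabs (heat v (y - b) - heat (v + p * b ^ 2) (y - p * b)
        + b * heat_y (v + p * b ^ 2) (y - p * b)) <= 3 * K * (b ^ 2 + p * b).
Proof.
move=> vv [p0 p1] [b0 b1]; set u := v + _; set z := y - p * b.
have K0 := heat_const_gt0.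
have vu : v <= u by rewrite /u; nra.
have [t1 t2] := heat_time z vv vu.
have h0 : 0 <= (1 - p) * b by nra.
have t3 := heat_taylor z vv h0.
have [t4 _ _] := heat_bounds z vv; rewrite -/K in t4.
have zE : z - (1 - p) * b = y - b by rewrite /z; ring.
rewrite zE in t3.
have -> : heat v (y - b) - heat u z + b * heat_y u z
  = (heat v (y - b) - heat v z + (1 - p) * b * heat_y v z) - (heat u z - heat v z)
    + b * (heat_y u z - heat_y v z) + p * b * heat_y v z by ring.
have uv : u - v = p * b ^ 2 by rewrite /u; ring.
rewrite uv in t1 t2.
have tri x1 x2 x3 x4 : Rabs (x1 - x2 + x3 + x4) <= Rabs x1 + Rabs x2 + Rabs x3 + Rabs x4.
  rewrite /Rabs; do 5 case: Rcase_abs => ?; lra.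
apply: Rle_trans (tri _ _ _ _) _.
rewrite !(Rabs_mult b, Rabs_mult (p * b), Rabs_mult p) (Rabs_pos_eq b) // (Rabs_pos_eq p) //.
have r1 : b * Rabs (heat_y u z - heat_y v z) <= K * (p * b ^ 2).
  by have := Rabs_pos (heat_y u z - heat_y v z); nra.
have r2 : p * b * Rabs (heat_y v z) <= K * (p * b).
  by rewrite Rmult_comm; apply: Rmult_le_compat_r => //; nra.
have r3 : K * ((1 - p) * b) * ((1 - p) * b) <= K * b ^ 2.
  have -> : K * ((1 - p) * b) * ((1 - p) * b) = K * b ^ 2 * ((1 - p) ^ 2) by ring.
  have : 0 <= K * b ^ 2 by nra.
  have : (1 - p) ^ 2 <= 1 by nra.
  nra.
have r4 : K * (p * b ^ 2) <= K * b ^ 2.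
  apply: Rmult_le_compat_l; first lra.
  nra.
have r5 : 0 <= K * b ^ 2 by nra.
have r6 : 0 <= K * (p * b) by apply: Rmult_le_pos; nra.
nra.
Qed.

(* One step of the record walk (a jump b with probability p) against one step of
   the heat flow with the same mean and variance up to p^2 b^2. *)
Lemma heat_step v p b y : v0 <= v -> 0 <= p <= 1 -> 0 <= b <= 1 ->
  Rabs ((1 - p) * normal_cdf (y / sqrt v) + p * normal_cdf ((y - b) / sqrt v)
        - normal_cdf ((y - p * b) / sqrt (v + p * b ^ 2)))
    <= 3 * K * (p * b ^ 3 + p ^ 2 * b ^ 2).
Proof.
move=> vv p01 b01; have v_gt0 : 0 < v by lra.
have K0 := heat_const_gt0; have [k0 k1] := gauss_cst_bound.
(* The jump size is interpolated from 0 to b. The error vanishes at t = 0, and its derivative is O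
   (p (b^2 + p b)), which integrates to p b^3 + p^2 b^2. *)
pose Rm t := (1 - p) * normal_cdf (y / sqrt v) + p * normal_cdf ((y - t) / sqrt v)
        - normal_cdf ((y - p * t) / sqrt (v + p * t ^ 2)).
pose dR t := - (gauss_cst * p) * (heat v (y - t) - heat (v + p * t ^ 2) (y - p * t)
        + t * heat_y (v + p * t ^ 2) (y - p * t)).
have Rm0 : Rm 0 = 0.
  rewrite /Rm Rminus_0_r Rmult_0_r Rminus_0_r.
  have -> : v + p * 0 ^ 2 = v by ring.
  by ring.
have gh u x : 0 < u -> gauss (x / sqrt u) = sqrt u * heat u x.
  move=> u0; have s0 := sqrt_lt_R0 _ u0; have ss := sqrt_sqrt u (Rlt_le _ _ u0).
  rewrite /heat /gauss.
  have -> : - (x / sqrt u) ^ 2 / 2 = - (x ^ 2 / (2 * u)).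
    by rewrite -{2}ss; field; lra.
  by field; lra.
have D t : 0 <= t <= b -> is_derive Rm t (dR t).
  move=> tb; have u0 : 0 < v + p * t ^ 2 by nra.
  have s0 := sqrt_lt_R0 _ u0; have s0' := sqrt_lt_R0 _ v_gt0.
  have su := sqrt_sqrt _ (Rlt_le _ _ u0).
  evar_last.
    apply: is_derive_minus; first apply: is_derive_plus; first exact: is_derive_const.
      apply: is_derive_scal; apply: (is_derive_comp normal_cdf).
        exact: is_derive_normal_cdf.
      by auto_derive.
    apply: (is_derive_comp normal_cdf (fun t => (y - p * t) / sqrt (v + p * t ^ 2))).
      exact: is_derive_normal_cdf.
    auto_derive; last by reflexivity.
    by move: u0 s0; rewrite /= => u0 s0; repeat split; lra.
  rewrite /dR !gh // /minus /plus /opp /zero /scal /= /mult /=.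
  rewrite /heat_y; move: s0 su; rewrite /=.
  set U := v + _; set s := sqrt U => s0 su.
  set h1 := heat v _; set h2 := heat U _.
  rewrite -su; field; lra.
have -> : (1 - p) * normal_cdf (y / sqrt v) + p * normal_cdf ((y - b) / sqrt v)
        - normal_cdf ((y - p * b) / sqrt (v + p * b ^ 2)) = Rm b - Rm 0.
  by rewrite Rm0 Rminus_0_r.
have -> : 3 * K * (p * b ^ 3 + p ^ 2 * b ^ 2) = (3 * K * p * (b ^ 2 + p * b)) * (b - 0) by ring.
apply: (@lipschitz_of_derive Rm dR) => // [|t tb]; first lra.
rewrite /dR Rabs_mult Rabs_Ropp (Rabs_pos_eq (_ * _)); last by nra.
have t01 : 0 <= t <= 1 by lra.
have := @heat_bracket v p t y vv p01 t01; set X := Rabs _ => le.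
have X0 : 0 <= X by exact: Rabs_pos.
have tb2 : t ^ 2 + p * t <= b ^ 2 + p * b by nra.
have le' : X <= 3 * K * (b ^ 2 + p * b).
  by apply: Rle_trans le _; apply: Rmult_le_compat_l; lra.
have -> : 3 * K * p * (b ^ 2 + p * b) = p * (3 * K * (b ^ 2 + p * b)) by ring.
apply: (Rle_trans _ (p * X)); last by apply: Rmult_le_compat_l; lra.
apply: Rmult_le_compat_r => //; nra.
Qed.

End HeatBounds.

(** * The central limit theorem for the sum of the logarithms *)

Section RecordCLT.
Variables (v0 c a B : R) (N : nat).
Hypotheses (v0_gt0 : 0 < v0) (a0 : 0 <= a) (aB : a * ln (INR N) <= B) (B1 : B <= 1).

Let f x := normal_cdf ((c - x) / sqrt v0).
Let K := 3 * heat_const v0.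

Lemma record_sum_ge0 k n : 0 <= record_sum k n.
Proof.
apply: rsum_ge0 => i _; apply: Rmult_le_pos; last exact: inv_INR_ge0.
exact/pow_le/ln_INR_ge0.
Qed.

(** Averaging the induction hypothesis at s and s + b with weights 1 - p and p does not enlarge its
    error, so the one-step errors of [heat_step] simply add up. *)
Lemma record_mean_normal m s : (m <= N)%N ->
  Rabs (record_mean f a m s
        - normal_cdf ((c - s - a * record_sum 1 m) / sqrt (v0 + a ^ 2 * record_sum 2 m)))
    <= K * (B ^ 3 * \rsum_(i < m) / INR i.+2 + B ^ 2 * \rsum_(i < m) (/ INR i.+2) ^ 2).
Proof.
have K0 : 0 < K by have := heat_const_gt0 v0_gt0; rewrite /K; lra.
elim: m s => [|m IHm] s mN.
  rewrite /record_sum !big_ord0 /= /f.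
  have -> : c - s - a * R0 = c - s by ring.
  have -> : v0 + a * (a * 1) * R0 = v0 by ring.
  by rewrite Rminus_diag Rabs_R0; lra.
pose p := / INR m.+2; pose b := a * ln (INR m.+1).
have p0 : 0 < p by apply/Rinv_0_lt_compat/INR_gt0.
have m2 : 2 <= INR m.+2 by rewrite !S_INR; have := pos_INR m; lra.
have p1 : p <= / 2 by apply: Rinv_le_contravar; lra.
have b0 : 0 <= b by apply: Rmult_le_pos => //; exact: ln_INR_ge0.
have bB : b <= B.
  apply: Rle_trans aB; apply: Rmult_le_compat_l => //; exact: ln_INR_le.
pose v := v0 + a ^ 2 * record_sum 2 m; pose y := c - s - a * record_sum 1 m.
have vv : v0 <= v.
  rewrite /v; have := record_sum_ge0 2 m; have := pow2_ge_0 a; nra.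
have eS k : record_sum k m.+1 = record_sum k m + ln (INR m.+1) ^ k / INR m.+2.
  by rewrite /record_sum big_ord_recr.
have eV : v0 + a ^ 2 * record_sum 2 m.+1 = v + p * b ^ 2.
  by rewrite eS /v /b /p /Rdiv; ring.
have eM : c - s - a * record_sum 1 m.+1 = y - p * b.
  by rewrite eS /y /b /p /Rdiv; ring.
have eR : record_mean f a m.+1 s = (1 - p) * record_mean f a m s + p * record_mean f a m (s + b).
  rewrite {1}/record_mean -/record_mean -/b /p.
  have -> : INR m.+1 = INR m.+2 - 1 by rewrite (S_INR m.+1); ring.
  field; lra.
rewrite eV eM eR !big_ord_recr.
have h1 := IHm s (ltnW mN); have h2 := IHm (s + b) (ltnW mN).
have ey : c - (s + b) - a * record_sum 1 m = y - b by rewrite /y; ring.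
rewrite ey -/v -/y in h1 h2.
have p01 : 0 <= p <= 1 by lra.
have b01 : 0 <= b <= 1 by lra.
have step := @heat_step v0 v0_gt0 v p b y vv p01 b01.
rewrite -/K in step.
set S1 := \big[_/_]_(_ < m) _ in h1 h2 *; set S2 := \big[_/_]_(_ < m) _ in h1 h2 *.
change (Rabs ((1 - p) * record_mean f a m s + p * record_mean f a m (s + b)
   - normal_cdf ((y - p * b) / sqrt (v + p * b ^ 2))) <= K * (B ^ 3 * (S1 + p) + B ^ 2 * (S2 + p ^ 2))).
move: h1 h2 step.
set r1 := record_mean _ _ _ _; set r2 := record_mean _ _ _ _.
set n1 := normal_cdf (y / _); set n2 := normal_cdf ((y - b) / _); set n3 := normal_cdf _.
set Er := K * (B ^ 3 * S1 + _) => h1 h2 step.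
have -> : (1 - p) * r1 + p * r2 - n3
  = (1 - p) * (r1 - n1) + p * (r2 - n2) + ((1 - p) * n1 + p * n2 - n3) by ring.
apply: Rle_trans (Rabs_triang _ _) _.
have t1 : Rabs ((1 - p) * (r1 - n1) + p * (r2 - n2)) <= Er.
  apply: Rle_trans (Rabs_triang _ _) _.
  rewrite !Rabs_mult (Rabs_pos_eq p) ?(Rabs_pos_eq (1 - p)); [nra|lra|lra].
have t2 : K * (p * b ^ 3 + p ^ 2 * b ^ 2) <= K * (p * B ^ 3 + p ^ 2 * B ^ 2).
  apply: Rmult_le_compat_l; first lra.
  have b3 : b ^ 3 <= B ^ 3 by apply: pow_incr.
  have b2 : b ^ 2 <= B ^ 2 by apply: pow_incr.
  have := pow2_ge_0 p; nra.
have -> : K * (B ^ 3 * (S1 + p) + B ^ 2 * (S2 + p ^ 2)) = Er + K * (p * B ^ 3 + p ^ 2 * B ^ 2).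
  by rewrite /Er; ring.
by rewrite -/K in step; lra.
Qed.

End RecordCLT.

Lemma sum_inv_le_harmonic n : \rsum_(i < n.-1) / INR i.+2 <= harmonic n.
Proof.
case: n => [|n]; first by rewrite /harmonic !big_ord0; exact: Rle_refl.
rewrite /harmonic big_ord_recl /= Rinv_1 -[X in X <= _]Rplus_0_l.
by apply: Rplus_le_compat_r; lra.
Qed.

Definition norm_scale n := / sqrt (/ 3 * ln (INR n) ^ 3).

Lemma norm_scale_sqr n : 0 < ln (INR n) ->
  0 < norm_scale n /\ norm_scale n ^ 2 * ln (INR n) ^ 3 = 3.
Proof.
move=> L0; have L3 : 0 < / 3 * ln (INR n) ^ 3 by have := pow_lt _ 3 L0; lra.
have s0 := sqrt_lt_R0 _ L3; have ss := sqrt_sqrt _ (Rlt_le _ _ L3).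
split; first exact: Rinv_0_lt_compat.
rewrite /norm_scale; move: s0 ss; set s := sqrt _ => s0 ss.
have -> : ln (INR n) ^ 3 = 3 * (s * s) by lra.
by field; lra.
Qed.

Lemma norm_scale_le n T : 0 < T -> ln (INR n) = T ^ 2 -> norm_scale n <= 2 / T ^ 3.
Proof.
move=> T0 LT; have L0 : 0 < ln (INR n) by rewrite LT; nra.
have [a0 e] := norm_scale_sqr L0; rewrite LT in e.
have T3 := pow_lt _ 3 T0.
apply: (Rmult_le_reg_r (T ^ 3)) => //.
have -> : 2 / T ^ 3 * T ^ 3 = 2 by field; lra.
have e' : (norm_scale n * T ^ 3) ^ 2 = 3 by rewrite -e; ring.
have : 0 < norm_scale n * T ^ 3 by nra.
nra.
Qed.

Lemma sqrt_ln_facts n : 4 <= ln (INR n) ->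
  2 <= sqrt (ln (INR n)) /\ ln (INR n) = sqrt (ln (INR n)) ^ 2.
Proof.
move=> L4; split; last by rewrite -Rsqr_pow2 Rsqr_sqrt //; lra.
have e : sqrt (2 * 2) = 2 by apply: sqrt_square; lra.
by rewrite -[X in X <= _]e; apply: sqrt_le_1_alt; lra.
Qed.

Lemma ln_gt0_nat n : 0 < ln (INR n) -> (0 < n)%N.
Proof. by case: n => // ; rewrite /ln /=; case: Rlt_dec => [/Rlt_irrefl//|_ /Rlt_irrefl]. Qed.

Lemma smooth_clt v0 c : 0 < v0 -> exists2 C, 0 <= C & forall n, 4 <= ln (INR n) ->
  Rabs (cycle_mean n (fun t => normal_cdf
          ((c - (sum_ln t - / 2 * ln (INR n) ^ 2) * norm_scale n) / sqrt v0))
        - normal_cdf (c / sqrt (1 + v0))) <= C / sqrt (ln (INR n)).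
Proof.
move=> v0_gt0; have s0 := sqrt_lt_R0 _ v0_gt0.
have K0 := heat_const_gt0 v0_gt0.
(* In units of 1 / sqrt (log n): 4 from passing to the record walk, 6 from its mean, 12 |c| from its
   variance, and 20 covers the 12 + 3 of the two Lindeberg sums. *)
exists ((10 + 12 * Rabs c) / sqrt v0 + 3 * heat_const v0 * 20).
  apply: Rplus_le_le_0_compat; last lra.
  by apply: Rdiv_le_0_compat => //; have := Rabs_pos c; lra.
move=> n L4; have [T2 LT] := sqrt_ln_facts L4.
have n0 : (0 < n)%N by apply: ln_gt0_nat; lra.
set T := sqrt _ in T2 LT *.
have T0 : 0 < T by lra.
set L := ln (INR n) in L4 LT *.
have aT := norm_scale_le T0 LT.
have L0 : 0 < ln (INR n) by rewrite -/L; lra.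
have [a0 ae] := norm_scale_sqr L0; rewrite -/L in ae.
set a := norm_scale n in aT a0 ae *.
have r0 : 0 < / T by exact: Rinv_0_lt_compat.
have aL : a * L <= 2 / T.
  have -> : 2 / T = 2 / T ^ 3 * L by rewrite LT; field; lra.
  by apply: Rmult_le_compat_r => //; lra.
have r1 : / T <= / 2 by apply: Rinv_le_contravar; lra.
have aL1 : a * L <= 1 by rewrite /Rdiv in aL; lra.
have H0 := harmonic_ge0 n; have HL := harmonic_ln n0; rewrite -/L in HL.
have aL0 : 0 <= a * L by nra.
have aH : a * harmonic n <= 4 / T.
  have : a * harmonic n <= a * (2 * L) by apply: Rmult_le_compat_l; lra.
  by rewrite /Rdiv in aL *; lra.
pose f x := normal_cdf ((c - x) / sqrt v0).
pose s := - (a * (L ^ 2 / 2)).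
have lip x y : Rabs (f x - f y) <= / sqrt v0 * Rabs (x - y).
  apply: Rle_trans (normal_cdf_lipschitz _ _) _.
  have -> : (c - x) / sqrt v0 - (c - y) / sqrt v0 = / sqrt v0 * (y - x) by field; lra.
  rewrite Rabs_mult (Rabs_pos_eq (/ _)); last by apply/Rlt_le/Rinv_0_lt_compat.
  by rewrite (Rabs_minus_sym x); exact: Rle_refl.
have i0 : 0 < / sqrt v0 by exact: Rinv_0_lt_compat.
have cmp := @cycle_mean_record_mean f (/ sqrt v0) a (Rlt_le _ _ i0) (Rlt_le _ _ a0) lip n s.
have -> : cycle_mean n (fun t => normal_cdf ((c - (sum_ln t - / 2 * L ^ 2) * a) / sqrt v0))
  = cycle_mean n (fun t => f (s + a * sum_ln t)).
  by apply: cycle_mean_ext => t; rewrite /f /s; congr (normal_cdf (_ / _)); field.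
rewrite -/L in cmp.
have rec := @record_mean_normal v0 c a (a * L) n v0_gt0 (Rlt_le _ _ a0) (Rle_refl _) aL1
   n.-1 (s + a * L) (leq_pred n).
rewrite -/f in rec.
have [m1 m2] := record_sum1 n0; have [w1 w2] := record_sum2 n0.
rewrite -/L in m1 m2 w1 w2.
set M := record_sum 1 _ in m1 m2 rec; set W := record_sum 2 _ in w1 w2 rec.
have W0 : 0 <= W by exact: record_sum_ge0.
set x := c - (s + a * L) - a * M in rec; set D := v0 + a ^ 2 * W in rec.
have xb : Rabs (x - c) <= 6 / T.
  have -> : x - c = a * (L ^ 2 / 2 - M - L) by rewrite /x /s; ring.
  rewrite Rabs_mult (Rabs_pos_eq a); last lra.
  apply: (Rle_trans _ (a * (3 * L))).
    by apply: Rmult_le_compat_l; [lra | apply: Rabs_le; lra].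
  by rewrite /Rdiv in aL *; lra.
have a2L : a ^ 2 * L ^ 2 <= 3 / T.
  have -> : 3 / T = a ^ 2 * L ^ 2 * (L / T) by rewrite -ae; field; lra.
  have -> : L / T = T by rewrite LT; field; lra.
  by have := pow2_ge_0 (a * L); nra.
have Vb : Rabs (a ^ 2 * W - 1) <= 12 / T.
  have -> : a ^ 2 * W - 1 = - (a ^ 2 * (L ^ 3 / 3 - W)) by lra.
  rewrite Rabs_Ropp Rabs_pos_eq; last by apply: Rmult_le_pos => //; exact: pow2_ge_0.
  apply: (Rle_trans _ (a ^ 2 * (4 * L ^ 2))).
    apply: Rmult_le_compat_l; first exact: pow2_ge_0.
    by apply: Rle_trans w2 _; nra.
  by rewrite /Rdiv in a2L *; lra.
have Dv0 : v0 <= D by rewrite /D; have := pow2_ge_0 a; nra.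
have sD : sqrt v0 <= sqrt D by exact: sqrt_le_1_alt.
have s1 : 1 <= sqrt (1 + v0) by rewrite -{1}sqrt_1; apply: sqrt_le_1_alt; lra.
have sDD : sqrt D * sqrt D = D by apply: sqrt_sqrt; lra.
have s11 : sqrt (1 + v0) * sqrt (1 + v0) = 1 + v0 by apply: sqrt_sqrt; lra.
have inv_diff : Rabs (/ sqrt D - / sqrt (1 + v0)) <= 12 / T / sqrt v0.
  have -> : / sqrt D - / sqrt (1 + v0)
    = - (a ^ 2 * W - 1) * / (sqrt D * sqrt (1 + v0) * (sqrt D + sqrt (1 + v0))).
    have -> : - (a ^ 2 * W - 1)
      = sqrt (1 + v0) * sqrt (1 + v0) - sqrt D * sqrt D by rewrite s11 sDD /D; ring.
    by move: sD s1; set sd := sqrt D; set se := sqrt (1 + v0) => sD s1; field; lra.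
  have g0 : sqrt v0 <= sqrt D * sqrt (1 + v0) * (sqrt D + sqrt (1 + v0)).
    have : sqrt v0 <= sqrt D * sqrt (1 + v0) by nra.
    nra.
  rewrite Rabs_mult Rabs_Ropp (Rabs_pos_eq (/ _)); last by apply/Rlt_le/Rinv_0_lt_compat; lra.
  apply: Rmult_le_compat => //; first exact: Rabs_pos.
    by apply/Rlt_le/Rinv_0_lt_compat; lra.
  exact: Rinv_le_contravar.
have last : Rabs (normal_cdf (x / sqrt D) - normal_cdf (c / sqrt (1 + v0)))
    <= (6 + 12 * Rabs c) / sqrt v0 / T.
  apply: Rle_trans (normal_cdf_lipschitz _ _) _.
  have -> : x / sqrt D - c / sqrt (1 + v0)
    = (x - c) * / sqrt D + c * (/ sqrt D - / sqrt (1 + v0)) by field; lra.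
  apply: Rle_trans (Rabs_triang _ _) _; rewrite !Rabs_mult.
  have -> : (6 + 12 * Rabs c) / sqrt v0 / T
    = (6 / T) * / sqrt v0 + Rabs c * (12 / T / sqrt v0) by field; lra.
  apply: Rplus_le_compat; last by apply: Rmult_le_compat_l => //; exact: Rabs_pos.
  rewrite (Rabs_pos_eq (/ _)); last by apply/Rlt_le/Rinv_0_lt_compat; lra.
  apply: Rmult_le_compat => //; first exact: Rabs_pos.
    by apply/Rlt_le/Rinv_0_lt_compat; lra.
  exact: Rinv_le_contravar.
have err : 3 * heat_const v0 * ((a * L) ^ 3 * \rsum_(i < n.-1) / INR i.+2
     + (a * L) ^ 2 * \rsum_(i < n.-1) (/ INR i.+2) ^ 2) <= 3 * heat_const v0 * 20 / T.
  rewrite /Rdiv [X in _ <= X]Rmult_assoc; apply: Rmult_le_compat_l; first lra.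
  have S1 := sum_inv_le_harmonic n; have S2 := sum_inv_sqr n.-1.
  have S20 : 0 <= \rsum_(i < n.-1) (/ INR i.+2) ^ 2.
    by apply: rsum_ge0 => i _; exact: pow2_ge_0.
  move: S1 S2 S20; set S1 := \big[_/_]_(_ < _) _; set S2 := \big[_/_]_(_ < _) _ => S1H S21 S20.
  have a2 : (a * L) ^ 2 <= 3 / T by have -> : (a * L) ^ 2 = a ^ 2 * L ^ 2 by ring.
  have a20 := pow2_ge_0 (a * L).
  have t2 : (a * L) ^ 2 * S2 <= 3 / T by nra.
  have t1 : (a * L) ^ 3 * S1 <= 12 / T.
    apply: (Rle_trans _ ((a * L) ^ 3 * (2 * L))).
      by apply: Rmult_le_compat_l; [exact: pow_le | lra].
    have -> : (a * L) ^ 3 * (2 * L) = 2 * (a * L) * (a ^ 2 * L ^ 3) by ring.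
    by rewrite ae; rewrite /Rdiv in aL *; lra.
  by rewrite /Rdiv in t1 t2; lra.
set E := cycle_mean _ _ in cmp *; set Rr := record_mean _ _ _ _ in cmp rec.
have -> : E - normal_cdf (c / sqrt (1 + v0))
  = (E - Rr) + ((Rr - normal_cdf (x / sqrt D))
      + (normal_cdf (x / sqrt D) - normal_cdf (c / sqrt (1 + v0)))).
  by ring.
apply: Rle_trans (Rabs_triang _ _) _.
have tri := Rabs_triang (Rr - normal_cdf (x / sqrt D))
  (normal_cdf (x / sqrt D) - normal_cdf (c / sqrt (1 + v0))).
have -> : ((10 + 12 * Rabs c) / sqrt v0 + 3 * heat_const v0 * 20) / T
  = (4 / T) * / sqrt v0 + (6 + 12 * Rabs c) / sqrt v0 / T + 3 * heat_const v0 * 20 / T.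
  by field; lra.
have : a * / sqrt v0 * harmonic n <= 4 / T * / sqrt v0.
  have -> : a * / sqrt v0 * harmonic n = a * harmonic n * / sqrt v0 by ring.
  by apply: Rmult_le_compat_r => //; lra.
lra.
Qed.

(** * Wreath products *)

Lemma dvdn_card_porbit (T : finType) (s : {perm T}) (x : T) m :
  (#|porbit s x| %| m)%N = ((s ^+ m)%g x == x).
Proof.
set N := #|porbit s x|.
have N0 : (0 < N)%N by rewrite card_gt0; apply/set0Pn; exists x; exact: porbit_id.
have sN q : (s ^+ (q * N))%g x = x.
  elim: q => [|q IHq]; first by rewrite mul0n expg0 perm1.
  by rewrite mulSn addnC expgD permM IHq permX iter_porbit.
apply/idP/eqP => [/dvdnP[q ->] //|]; rewrite {1}(divn_eq m N) expgD permM sN permX => e.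
rewrite /dvdn; apply/negPn/negP; rewrite -lt0n => r0.
have rN : (m %% N < N)%N by rewrite ltn_mod.
have u := uniq_traject_porbit s x; rewrite -/N in u.
have := nth_uniq x (s := traject s x N) (i := m %% N) (j := 0).
rewrite size_traject => /(_ rN N0 u).
by rewrite !nth_traject //= e eqxx => /esym/eqP r; rewrite r in r0.
Qed.

(** Turns [lcm_cycles] into the order of s, so that divisibilities are proved by evaluating powers
    at points. *)
Lemma dvdn_lcm_cycles (T : finType) (s : {perm T}) m :
  (lcm_cycles s %| m)%N <-> forall x, (s ^+ m)%g x = x.
Proof.
rewrite /lcm_cycles; split=> [/dvdn_biglcmP H x|H].
  by apply/eqP; rewrite -dvdn_card_porbit H // imset_f.
by apply/dvdn_biglcmP => C /imsetP[x _ ->]; rewrite dvdn_card_porbit H.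
Qed.

Lemma lcm_cycles_gt0 (T : finType) (s : {perm T}) : (0 < lcm_cycles s)%N.
Proof.
rewrite /lcm_cycles; elim/big_ind: _ => // [a b a0 b0|C /imsetP[x _ ->]].
  by rewrite lcmn_gt0 a0.
by rewrite card_gt0; apply/set0Pn; exists x; exact: porbit_id.
Qed.

Lemma lcm_cycles_lcm_seq (T : finType) (s : {perm T}) :
  lcm_cycles s = lcm_seq (cycle_lengths setT s).
Proof.
rewrite /lcm_cycles /lcm_seq /cycle_lengths big_map big_enum /=.
by apply: eq_bigl => C; apply/imsetP/imsetP => -[x _ ->]; exists x.
Qed.

Lemma cycle_lengths_bound n (h : {perm 'I_n}) :
  all (fun l => 0 < l <= n)%N (cycle_lengths setT h).
Proof.
apply/allP => l /mapP[C]; rewrite mem_enum => /imsetP[x _ ->] ->.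
have := max_card (porbit h x); rewrite card_ord => ->; rewrite andbT card_gt0.
by apply/set0Pn; exists x; exact: porbit_id.
Qed.

Section WreathPower.
Variables (k n : nat) (Gamma : {group {perm 'I_k}}).
Variable (p : {ffun 'I_n -> {perm 'I_k}} * {perm 'I_n}).
Hypotheses (k0 : (0 < k)%N) (pG : p \in wreath n Gamma).

Definition wr_pt (i : 'I_n) (r : 'I_k) : 'I_(k * n) := Ordinal (wr_img_lt i r).

Lemma wr_blk_pt i r : wr_blk (wr_pt i r) = i.
Proof. by apply: val_inj; rewrite /= divnMDl // divn_small ?addn0. Qed.

Lemma wr_pos_pt i r : wr_pos (wr_pt i r) = r.
Proof. by apply: val_inj; rewrite /= modnMDl modn_small. Qed.

Lemma wr_ptK x : wr_pt (wr_blk x) (wr_pos x) = x.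
Proof. by apply: val_inj; rewrite /= -divn_eq. Qed.

Lemma wr_perm_pt i r : wr_perm p (wr_pt i r) = wr_pt (p.2 i) (p.1 i r).
Proof. by rewrite permE; apply: val_inj; rewrite /= -/(wr_blk _) wr_blk_pt wr_pos_pt. Qed.

(** The explicit cocycle is irrelevant; only its membership in Gamma matters. *)
Lemma wr_perm_power m : exists gam : 'I_n -> {perm 'I_k},
  (forall i, gam i \in Gamma) /\
  forall i r, (wr_perm p ^+ m)%g (wr_pt i r) = wr_pt ((p.2 ^+ m)%g i) (gam i r).
Proof.
elim: m => [|m [gam [gG gE]]].
  by exists (fun=> 1%g); split=> [i|i r]; [exact: group1 | rewrite !expg0 !perm1].
exists (fun i => gam i * p.1 ((p.2 ^+ m)%g i))%g; split=> [i|i r].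
  by rewrite groupM //; move: pG; rewrite inE => /forallP; apply.
by rewrite !expgSr !permM gE wr_perm_pt.
Qed.

Lemma lcm_cycles_dvd_wr : (lcm_cycles p.2 %| lcm_cycles (wr_perm p))%N.
Proof.
apply/dvdn_lcm_cycles => i; have [gam [_ gE]] := wr_perm_power (lcm_cycles (wr_perm p)).
(* k > 0 provides a point in every block, on which the action of h on blocks can be read off. *)
have := gE i (Ordinal k0).
rewrite (proj1 (dvdn_lcm_cycles _ _) (dvdnn _)) => /(congr1 (@wr_blk k n)).
by rewrite !wr_blk_pt.
Qed.

Lemma lcm_cycles_wr_dvd : (lcm_cycles (wr_perm p) %| lcm_cycles p.2 * #|Gamma|)%N.
Proof.
set O := lcm_cycles p.2; have [gam [gG gE]] := wr_perm_power O.
have hO := proj1 (dvdn_lcm_cycles p.2 O) (dvdnn _).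
have H i r j : (wr_perm p ^+ (O * j))%g (wr_pt i r) = wr_pt i ((gam i ^+ j)%g r).
  elim: j => [|j IHj]; first by rewrite muln0 !expg0 !perm1.
  by rewrite mulnSr expgD permM IHj gE hO expgSr permM.
by apply/dvdn_lcm_cycles => x; rewrite -(wr_ptK x) H expg_cardG // perm1.
Qed.

Lemma ln_lcm_cycles_wr :
  ln (INR (lcm_cycles p.2)) <= ln (INR (lcm_cycles (wr_perm p)))
    <= ln (INR (lcm_cycles p.2)) + ln (INR #|Gamma|).
Proof.
split.
  by apply: ln_INR_le; apply: dvdn_leq lcm_cycles_dvd_wr; exact: lcm_cycles_gt0.
rewrite -ln_mult; [|apply: INR_gt0; exact: lcm_cycles_gt0|apply: INR_gt0; exact: cardG_gt0].
rewrite -mult_INR; apply: ln_INR_le; apply: dvdn_leq lcm_cycles_wr_dvd.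
by rewrite muln_gt0 lcm_cycles_gt0 cardG_gt0.
Qed.

End WreathPower.

Lemma sum_wreath k n (Gamma : {group {perm 'I_k}}) (F : seq nat -> R) : symmetric_seq F ->
  \rsum_(p in wreath n Gamma) F (cycle_lengths setT p.2)
  = INR #|wreath n Gamma| * cycle_mean n F.
Proof.
move=> sF.
have H (G : seq nat -> R) : symmetric_seq G ->
  \rsum_(p in wreath n Gamma) G (cycle_lengths setT p.2)
  = INR #|[set g : {ffun 'I_n -> {perm 'I_k}} | [forall i, g i \in Gamma]]|
    * (INR n`! * cycle_mean n G).
  move=> sG; rewrite -sum_perm_cycle_mean // -rsum_card_const.
  transitivity (\rsum_(g : {ffun 'I_n -> {perm 'I_k}} | [forall i, g i \in Gamma])
     \rsum_(h : {perm 'I_n}) G (cycle_lengths setT h)).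
    by rewrite pair_big /=; apply: eq_bigl => q; rewrite inE andbT.
  by apply: eq_bigl => g; rewrite inE.
have c : INR #|wreath n Gamma| =
   INR #|[set g : {ffun 'I_n -> {perm 'I_k}} | [forall i, g i \in Gamma]]| * INR n`!.
  have := H (fun=> 1) (fun _ _ _ => erefl).
  by rewrite rsum_card_const cycle_mean_const !Rmult_1_r.
by rewrite H // c; ring.
Qed.

Lemma card_wreath_gt0 k n (Gamma : {group {perm 'I_k}}) : 0 < INR #|wreath n Gamma|.
Proof.
apply: INR_gt0; rewrite card_gt0; apply/set0Pn; exists ([ffun=> 1%g], 1%g).
by rewrite inE; apply/forallP => i; rewrite ffunE group1.
Qed.

Section CdfBounds.
Variables (k n : nat) (Gamma : {group {perm 'I_k}}) (x : R) (F : seq nat -> R).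
Hypothesis sF : symmetric_seq F.

Let ind (p : {ffun 'I_n -> {perm 'I_k}} * {perm 'I_n}) : R :=
  if Rleb (normalized_log_order p) x then 1 else R0.

Lemma cdf_wr_indicator :
  INR #|wreath n Gamma| * cdf_wr n Gamma x = \rsum_(p in wreath n Gamma) ind p.
Proof.
have w0 := card_wreath_gt0 n Gamma.
rewrite /cdf_wr /ind -big_mkcondr.
have -> : \big[Rplus/R0]_(p in wreath n Gamma | Rleb (normalized_log_order p) x) 1
  = INR #|[set p in wreath n Gamma | Rleb (normalized_log_order p) x]|.
  rewrite -[RHS]Rmult_1_r -rsum_card_const.
  by apply: eq_bigl => p; rewrite [in RHS]inE.
by field; lra.
Qed.

Lemma cdf_wr_le : (forall p, p \in wreath n Gamma -> ind p <= F (cycle_lengths setT p.2)) ->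
  cdf_wr n Gamma x <= cycle_mean n F.
Proof.
move=> H; apply: (Rmult_le_reg_l _ _ _ (card_wreath_gt0 n Gamma)).
by rewrite cdf_wr_indicator -sum_wreath //; exact: rsum_le.
Qed.

Lemma cdf_wr_ge : (forall p, p \in wreath n Gamma -> F (cycle_lengths setT p.2) <= ind p) ->
  cycle_mean n F <= cdf_wr n Gamma x.
Proof.
move=> H; apply: (Rmult_le_reg_l _ _ _ (card_wreath_gt0 n Gamma)).
by rewrite cdf_wr_indicator -sum_wreath //; exact: rsum_le.
Qed.
End CdfBounds.

Lemma ln_lcm_seq_le t : all (leq 1) t -> ln (INR (lcm_seq t)) <= sum_ln t.
Proof.
rewrite /lcm_seq /sum_ln; elim: t => [|l t IHt] /=.
  by rewrite !big_nil ln_1 => _; exact: Rle_refl.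
move=> /andP[l0 t0]; have := IHt t0; have := lcm_seq_gt0 t0; rewrite !big_cons /lcm_seq.
set m := \big[lcmn/_]_(_ <- _) _ => m0 le.
have : ln (INR (lcmn l m)) <= ln (INR (l * m)).
  apply: ln_INR_le; apply: dvdn_leq; first by rewrite muln_gt0 l0.
  by rewrite dvdn_lcm dvdn_mulr // dvdn_mull.
rewrite mult_INR ln_mult; [|exact: INR_gt0|exact: INR_gt0].
set S := \big[_/_]_(_ <- _) _ in le *; move=> le'; change (ln (INR (lcmn l m)) <= ln (INR l) + S).
lra.
Qed.

Definition norm_sum_ln n t := (sum_ln t - / 2 * ln (INR n) ^ 2) * norm_scale n.

Lemma normalized_log_order_near k n (Gamma : {group {perm 'I_k}}) p :
  (0 < k)%N -> p \in wreath n Gamma -> 0 < ln (INR n) ->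
  Rabs (normalized_log_order p - norm_sum_ln n (cycle_lengths setT p.2))
   <= norm_scale n * (lcm_defect n (cycle_lengths setT p.2) + ln (INR #|Gamma|)).
Proof.
move=> k0 pG L0; have [a0 _] := norm_scale_sqr L0.
have [l1 l2] := ln_lcm_cycles_wr k0 pG.
have b := cycle_lengths_bound p.2.
have d1 := lcm_defect_ge b.
have b1 : all (leq 1) (cycle_lengths setT p.2) by apply: sub_all b => l /andP[].
have d2 := ln_lcm_seq_le b1.
rewrite -lcm_cycles_lcm_seq in d1 d2.
have g0 := ln_INR_ge0 #|Gamma|.
rewrite /normalized_log_order /norm_sum_ln /Rdiv -/(norm_scale n).
set t := cycle_lengths _ _ in d1 d2 *.
have -> : (ln (INR (lcm_cycles (wr_perm p))) - / 2 * ln (INR n) ^ 2) * norm_scale n -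
   (sum_ln t - / 2 * ln (INR n) ^ 2) * norm_scale n
   = norm_scale n * (ln (INR (lcm_cycles (wr_perm p))) - sum_ln t) by ring.
rewrite Rabs_mult (Rabs_pos_eq (norm_scale n)); last lra.
have aux (x o w d g : R) : o <= x -> x <= o + g -> w - o <= d -> o <= w -> 0 <= g ->
  Rabs (x - w) <= d + g by move=> *; apply: Rabs_le; lra.
by apply: Rmult_le_compat_l; [lra | exact: (aux _ _ _ _ _ l1 l2 d1 d2 g0)].
Qed.

Lemma cycle_mean_defect_scaled n : 4 <= ln (INR n) ->
  norm_scale n * cycle_mean n (lcm_defect n) <= 512 / sqrt (sqrt (ln (INR n))).
Proof.
move=> L4; have [T2 LT] := sqrt_ln_facts L4.
have L0 : 0 < ln (INR n) by lra.
have n0 := ln_gt0_nat L0; have [a0 _] := norm_scale_sqr L0.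
have HL := harmonic_ln n0.
move: T2 LT; set T := sqrt (ln _) => T2 LT.
have T0 : 0 < T by lra.
have aT := norm_scale_le T0 LT.
have q0 : 0 < sqrt T by exact: sqrt_lt_R0.
have qq : sqrt T * sqrt T = T by apply: sqrt_sqrt; lra.
have R1 : Rpower (harmonic n) (5 / 4) <= 4 * (T ^ 2 * sqrt T).
  apply: (Rle_trans _ (Rpower (2 * T ^ 2) (5 / 4))).
    have H1 : 0 < harmonic n.
      have := harmonic_le n0; rewrite {1}/harmonic big_ord_recr big_ord0 /= Rinv_1; lra.
    by apply: Rle_Rpower_l; lra.
  rewrite -Rpower_mult_distr; [|lra|nra].
  have -> : Rpower (T ^ 2) (5 / 4) = T ^ 2 * sqrt T.
    rewrite -(Rpower_pow 2 T) // Rpower_mult -(Rpower_sqrt T) // -Rpower_plus.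
    by congr Rpower; rewrite /=; field.
  apply: Rmult_le_compat_r; first nra.
  apply: (Rle_trans _ (Rpower 2 (INR 2))); first by apply: Rle_Rpower => /=; lra.
  by rewrite Rpower_pow /=; lra.
have := cycle_mean_lcm_defect n0 => D.
apply: (Rle_trans _ (2 / T ^ 3 * (64 * (4 * (T ^ 2 * sqrt T))))).
  apply: Rmult_le_compat => //; [lra | | lra].
  rewrite -(cycle_mean_const n 0); apply: cycle_mean_le => t.
  by apply: rsum_ge0 => q _; apply: Rmult_le_pos; [exact: ln_INR_ge0 | exact: pos_INR].
have -> : 2 / T ^ 3 * (64 * (4 * (T ^ 2 * sqrt T))) = 512 / sqrt T; last exact: Rle_refl.
by rewrite -{1 2}qq; field; lra.
Qed.

(** * Convergence of the distribution functions *)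

Lemma ln_INR_unbounded M : eventually (fun n => M <= ln (INR n)).
Proof.
have [N N1] := INR_unbounded (exp M).
exists N => n /leP Nn; rewrite -(ln_exp M); apply: Rlt_le.
apply: ln_increasing; first exact: exp_pos.
by have := INR_leq Nn; lra.
Qed.

Lemma smooth_indicator x d s Y X Z : 0 < d -> 0 < s -> Rabs (Y - X) <= Z ->
  normal_cdf ((x - 2 * d - X) / s) - (/ (1 + (d / s) ^ 2 / 2) + / d * Z)
   <= (if Rleb Y x then 1 else R0)
   <= normal_cdf ((x + 2 * d - X) / s) + (/ (1 + (d / s) ^ 2 / 2) + / d * Z).
Proof.
move=> d0 s0 YX; set e := / (1 + _).
have e0 : 0 < e by apply: Rinv_0_lt_compat; have := pow2_ge_0 (d / s); lra.
have id0 := Rinv_0_lt_compat _ d0.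
have Z0 : 0 <= Z by apply: Rle_trans YX; exact: Rabs_pos.
have dZ0 : 0 <= / d * Z by nra.
have ds : 0 <= d / s by apply: Rdiv_le_0_compat; lra.
have [t1 t2] := normal_cdf_tail ds; rewrite -/e in t1.
have [lb1 lb2] := normal_cdf_bound ((x - 2 * d - X) / s).
have [ub1 ub2] := normal_cdf_bound ((x + 2 * d - X) / s).
have [X1 X2] : Y - Z <= X /\ X <= Y + Z.
  by have := Rle_abs (Y - X); have := Rle_abs (- (Y - X)); rewrite Rabs_Ropp; lra.
case: (Rle_dec d Z) => dZ.
  have : 1 <= / d * Z.
    have -> : 1 = / d * d by field; lra.
    by apply: Rmult_le_compat_l; lra.
  by case: (Rleb Y x); lra.
have is0 : 0 < / s by exact: Rinv_0_lt_compat.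
rewrite /Rleb; case: Rle_dec => Yx /=.
  have : normal_cdf (d / s) <= normal_cdf ((x + 2 * d - X) / s).
    by apply/normal_cdf_le/Rmult_le_compat_r; lra.
  by lra.
have : normal_cdf ((x - 2 * d - X) / s) <= normal_cdf (- (d / s)).
  have -> : - (d / s) = (- d) / s by field; lra.
  by apply/normal_cdf_le/Rmult_le_compat_r; lra.
rewrite normal_cdf_opp; lra.
Qed.

Lemma norm_scale_Rpower n : 4 <= ln (INR n) ->
  norm_scale n <= 2 * / Rpower (ln (INR n)) (3 / 2).
Proof.
move=> L4; have [T2 LT] := sqrt_ln_facts L4.
have T0 : 0 < sqrt (ln (INR n)) by lra.
apply: Rle_trans (norm_scale_le T0 LT) _.
have -> : Rpower (ln (INR n)) (3 / 2) = sqrt (ln (INR n)) ^ 3; last exact: Rle_refl.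
rewrite -(Rpower_pow 3) // -Rpower_sqrt; last lra.
by rewrite Rpower_mult; congr Rpower; rewrite /=; field.
Qed.

Lemma rescale_shift x c v d : 0 <= v -> Rabs (c - x) <= d ->
  Rabs (c / sqrt (1 + v) - x) <= d + Rabs x * v.
Proof.
move=> v0 cx; have s1 : 1 <= sqrt (1 + v) by rewrite -{1}sqrt_1; apply: sqrt_le_1_alt; lra.
have ss : sqrt (1 + v) * sqrt (1 + v) = 1 + v by apply: sqrt_sqrt; lra.
set s := sqrt (1 + v) in s1 ss *.
have i1 : / s <= 1 by rewrite -Rinv_1; apply: Rinv_le_contravar; lra.
have i0 : 0 < / s by apply: Rinv_0_lt_compat; lra.
have is1 : / s * s = 1 by field; lra.
have -> : c / s - x = (c - x) * / s + x * (/ s - 1) by field; lra.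
apply: Rle_trans (Rabs_triang _ _) _; rewrite !Rabs_mult.
apply: Rplus_le_compat.
  by rewrite (Rabs_pos_eq (/ s)); [have := Rabs_pos (c - x); nra | lra].
apply: Rmult_le_compat_l; first exact: Rabs_pos.
apply: Rabs_le; nra.
Qed.

Lemma cdf_wr_estimate k n (Gamma : {group {perm 'I_k}}) x d v0 :
  (0 < k)%N -> 4 <= ln (INR n) -> 0 < d -> 0 < v0 ->
  let err := / (1 + (d / sqrt v0) ^ 2 / 2)
     + / d * (512 / sqrt (sqrt (ln (INR n))) + norm_scale n * ln (INR #|Gamma|)) in
  let smooth c := cycle_mean n (fun t => normal_cdf
          ((c - (sum_ln t - / 2 * ln (INR n) ^ 2) * norm_scale n) / sqrt v0)) in
  smooth (x - 2 * d) - err <= cdf_wr n Gamma x <= smooth (x + 2 * d) + err.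
Proof.
move=> k0 L4 d0 v0_gt0 err smooth.
have L0 : 0 < ln (INR n) by lra.
have s0 := sqrt_lt_R0 _ v0_gt0.
pose e t := / (1 + (d / sqrt v0) ^ 2 / 2)
   + / d * (norm_scale n * (lcm_defect n t + ln (INR #|Gamma|))).
pose N c t := normal_cdf ((c - norm_sum_ln n t) / sqrt v0).
have id0 := Rinv_0_lt_compat _ d0.
have me : cycle_mean n e <= err.
  have -> : cycle_mean n e = / (1 + (d / sqrt v0) ^ 2 / 2)
     + / d * (norm_scale n * cycle_mean n (lcm_defect n) + norm_scale n * ln (INR #|Gamma|)).
    rewrite /e cycle_mean_add cycle_mean_const !cycle_mean_scal cycle_mean_add.
    by rewrite cycle_mean_const; ring.
  apply: Rplus_le_compat_l; apply: Rmult_le_compat_l; first lra.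
  by apply: Rplus_le_compat_r; exact: cycle_mean_defect_scaled.
have symW t u : perm_eq t u -> sum_ln t = sum_ln u.
  exact: (sum_ln_symmetric id).
have symD := @lcm_defect_symmetric n.
split.
  apply: (Rle_trans _ (cycle_mean n (fun t => N (x - 2 * d) t + - 1 * e t))).
    rewrite cycle_mean_add cycle_mean_scal.
    have -> : cycle_mean n (N (x - 2 * d)) = smooth (x - 2 * d) by [].
    lra.
  apply: cdf_wr_ge => [t u tu|p pG].
    by rewrite /N /e /norm_sum_ln (symW _ _ tu) (symD _ _ tu).
  have near := normalized_log_order_near k0 pG L0.
  have [h _] := smooth_indicator x d0 s0 near.
  apply: Rle_trans h; rewrite /N /e; apply: Req_le; ring.
apply: (Rle_trans _ (cycle_mean n (fun t => N (x + 2 * d) t + e t))).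
  apply: cdf_wr_le => [t u tu|p pG].
    by rewrite /N /e /norm_sum_ln (symW _ _ tu) (symD _ _ tu).
  have near := normalized_log_order_near k0 pG L0.
  by have [_ h] := smooth_indicator x d0 s0 near.
rewrite cycle_mean_add.
have -> : cycle_mean n (N (x + 2 * d)) = smooth (x + 2 * d) by [].
lra.
Qed.

Lemma wreath_log_order_clt (kf : nat -> nat) (G : forall n, {group {perm 'I_(kf n)}}) :
  (forall n, (0 < kf n)%N) ->
  is_lim_seq (fun n => ln (INR #|G n|) / Rpower (ln (INR n)) (3 / 2)) 0 ->
  conv_to_std_normal (fun n x => cdf_wr n (G n) x).
Proof.
move=> k0 limG x; apply/is_lim_seq_spec => eps; have eps0 := cond_pos eps.
set eta := pos eps in eps0 *.
pose m := 4 + Rabs x; have m4 : 4 <= m by have := Rabs_pos x; rewrite /m; lra.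
pose d := Rmin 1 (eta / (2 * m)).
have d0 : 0 < d by apply: Rmin_glb_lt; [lra | apply: Rdiv_lt_0_compat; lra].
have d1 : d <= 1 by exact: Rmin_l.
have dm : d * m <= eta / 2.
  have : d <= eta / (2 * m) by exact: Rmin_r.
  move=> /(Rmult_le_compat_r m) h.
  by have -> : eta / 2 = eta / (2 * m) * m; [field; lra | apply: h; lra].
pose s := d ^ 2; have s0 : 0 < s by exact: pow_lt.
pose v0 := s * s; have v00 : 0 < v0 by exact: Rmult_lt_0_compat.
have sv : sqrt v0 = s by apply: sqrt_square; lra.
have [C1 C10 clt1] := smooth_clt (x - 2 * d) v00.
have [C2 C20 clt2] := smooth_clt (x + 2 * d) v00.
pose Q := 4 * (C1 + C2 + 512 / d) / eta + 2.
have D0 : 0 < 512 / d by apply: Rdiv_lt_0_compat; lra.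
have Q2 : 2 <= Q.
  have : 0 <= 4 * (C1 + C2 + 512 / d) / eta by apply: Rdiv_le_0_compat; lra.
  by rewrite /Q; lra.
have de : 0 < eta * d / 8 by nra.
have evG := proj2 (is_lim_seq_spec _ _) limG (mkposreal _ de).
have evL := ln_INR_unbounded (Rmax 4 (Q ^ 4)).
apply: filter_imp (filter_and _ _ evG evL) => n [/= gn Ln].
have L4 : 4 <= ln (INR n) by apply: Rle_trans Ln; exact: Rmax_l.
have LQ : Q ^ 4 <= ln (INR n) by apply: Rle_trans Ln; exact: Rmax_r.
have [T2 LT] := sqrt_ln_facts L4.
have [lo hi] := @cdf_wr_estimate _ n (G n) x d v0 (k0 n) L4 d0 v00.
have {}clt1 := clt1 n L4; have {}clt2 := clt2 n L4.
have g0 := ln_INR_ge0 #|G n|.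
have ag : norm_scale n * ln (INR #|G n|) <= eta * d / 4.
  have le := norm_scale_Rpower L4.
  have aux (g r a e : R) : Rabs (g / r - 0) < e / 8 -> 0 <= g -> a <= 2 * / r -> a * g <= e / 4.
    rewrite /Rdiv => h gp ar; have := Rmult_le_compat_r _ _ _ gp ar.
    by have := Rle_abs (g * / r - 0); lra.
  exact: aux gn g0 le.
pose T := sqrt (ln (INR n)); pose S := sqrt T.
have SQ : Q <= S.
  have q2 : sqrt (Q * Q * (Q * Q)) = Q * Q by apply: sqrt_square; nra.
  have q1 : sqrt (Q * Q) = Q by apply: sqrt_square; lra.
  rewrite -q1; apply: sqrt_le_1_alt; rewrite -q2; apply: sqrt_le_1_alt.
  by have -> : Q * Q * (Q * Q) = Q ^ 4 by ring.
have iS : / T <= / S.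
  have SS : S * S = T by apply: sqrt_sqrt; rewrite /T; lra.
  by apply: Rinv_le_contravar; nra.
have Si0 : 0 < / S by apply: Rinv_0_lt_compat; lra.
have CS : (C1 + C2 + 512 / d) * / S < eta / 4.
  apply: (Rmult_lt_reg_r S); first lra.
  have -> : (C1 + C2 + 512 / d) * / S * S = C1 + C2 + 512 / d by field; lra.
  have : C1 + C2 + 512 / d = eta / 4 * (Q - 2) by rewrite /Q; field; lra.
  nra.
have tail : / (1 + (d / sqrt v0) ^ 2 / 2) <= 2 * d.
  rewrite sv; have -> : d / s = / d by rewrite /s; field; lra.
  have id1 : 1 <= / d by rewrite -Rinv_1; apply: Rinv_le_contravar; lra.
  have -> : 2 * d = / (/ d / 2) by field; lra.
  by apply: Rinv_le_contravar; nra.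
have vd : Rabs x * v0 <= Rabs x * d.
  apply: Rmult_le_compat_l; first exact: Rabs_pos.
  have sd : s <= d by rewrite /s; nra.
  by rewrite /v0; nra.
have id0 : 0 < / d by exact: Rinv_0_lt_compat.
have agd : / d * (norm_scale n * ln (INR #|G n|)) <= eta / 4.
  have -> : eta / 4 = / d * (eta * d / 4) by field; lra.
  by apply: Rmult_le_compat_l; lra.
have Ci : C1 / T + C2 / T + / d * (512 / S) <= (C1 + C2 + 512 / d) * / S.
  by rewrite /Rdiv; nra.
have C1T : 0 <= C1 / T by apply: Rdiv_le_0_compat; rewrite /T; lra.
have C2T : 0 <= C2 / T by apply: Rdiv_le_0_compat; rewrite /T; lra.
rewrite -/T in clt1 clt2; rewrite -/T -/S in lo hi.
have shift c : Rabs (c - x) <= 2 * d ->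
    Rabs (normal_cdf (c / sqrt (1 + v0)) - normal_cdf x) <= 2 * d + Rabs x * v0.
  move=> cx; apply: Rle_trans (normal_cdf_lipschitz _ _) _.
  by apply: rescale_shift; lra.
have sh1 : Rabs (normal_cdf ((x - 2 * d) / sqrt (1 + v0)) - normal_cdf x) <= 2 * d + Rabs x * v0.
  by apply: shift; apply: Rabs_le; lra.
have sh2 : Rabs (normal_cdf ((x + 2 * d) / sqrt (1 + v0)) - normal_cdf x) <= 2 * d + Rabs x * v0.
  by apply: shift; apply: Rabs_le; lra.
rewrite Phi_normal_cdf.
have dm' : 4 * d + Rabs x * d <= eta / 2 by rewrite /m in dm; lra.
have bnd u w z : Rabs (u - w) <= z -> - z <= u - w <= z.
  by have := Rle_abs (u - w); have := Rle_abs (- (u - w)); rewrite Rabs_Ropp; lra.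
have {}clt1 := bnd _ _ _ clt1; have {}clt2 := bnd _ _ _ clt2.
have {}sh1 := bnd _ _ _ sh1; have {}sh2 := bnd _ _ _ sh2.
move: lo hi clt1 clt2 sh1 sh2.
set E1 := cycle_mean _ _; set E2 := cycle_mean _ _ => lo hi clt1 clt2 sh1 sh2.
apply: Rabs_def1; lra.
Qed.

Lemma is_lim_inv_Rpower_ln :
  is_lim_seq (fun n => / Rpower (ln (INR n)) (3 / 2)) 0.
Proof.
apply/is_lim_seq_spec => eps; have e0 := cond_pos eps.
apply: filter_imp (ln_INR_unbounded (Rmax 4 (/ eps + 1))) => n Ln.
have L4 : 4 <= ln (INR n) by apply: Rle_trans Ln; exact: Rmax_l.
have Le : / eps + 1 <= ln (INR n) by apply: Rle_trans Ln; exact: Rmax_r.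
have ie : 0 < / eps by exact: Rinv_0_lt_compat.
have le : ln (INR n) <= Rpower (ln (INR n)) (3 / 2).
  rewrite -{1}(Rpower_1 (ln (INR n))); last lra.
  by apply: Rle_Rpower; lra.
rewrite Rminus_0_r Rabs_pos_eq; last by apply/Rlt_le/Rinv_0_lt_compat; lra.
rewrite -(Rinv_inv eps); apply: Rinv_lt_contravar; last lra.
by apply: Rmult_lt_0_compat; lra.
Qed.

Lemma card_cycle_full k (c : {perm 'I_k}) : (0 < k)%N -> is_full_cycle c ->
  (#|<[c]>%g| <= k)%N.
Proof.
move=> k0 full; apply: dvdn_leq => //; rewrite -/(#[c]%g) order_dvdn.
apply/eqP/permP => i; rewrite perm1.
by apply/eqP; rewrite -dvdn_card_porbit full cardsT card_ord.
Qed.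

Lemma ln_card_cycle_full k (c : {perm 'I_k}) y : (0 < k)%N -> is_full_cycle c ->
  0 <= ln (INR #|<[c]>%g|) / Rpower y (3 / 2) <= ln (INR k) / Rpower y (3 / 2).
Proof.
move=> k0 full; have p0 : 0 < / Rpower y (3 / 2) by apply/Rinv_0_lt_compat/exp_pos.
split; first by apply: Rmult_le_pos; [exact: ln_INR_ge0 | exact: Rlt_le].
apply: Rmult_le_compat_r; first exact: Rlt_le.
by apply: ln_INR_le; exact: card_cycle_full.
Qed.

Close Scope R_scope.

Theorem mainTheorem2 :
  (forall (k : nat) (Gamma : {group {perm 'I_k}}),
      (0 < k)%N ->
      conv_to_std_normal (fun n x => cdf_wr n Gamma x))
  /\
  (forall (kf : nat -> nat) (c : forall n : nat, {perm 'I_(kf n)}),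
      (forall n, (0 < kf n)%N) ->
      (forall n, is_full_cycle (c n)) ->
      is_lim_seq (fun n => Rdiv (ln (INR (kf n))) (Rpower (ln (INR n)) (Rdiv 3 2))) (Rbar.Finite R0) ->
      conv_to_std_normal (fun n x => cdf_wr n <[c n]>%g x)).
Proof.
split=> [k Gamma k0|kf c k0 full lim_k].
  apply: (@wreath_log_order_clt (fun=> k) (fun=> Gamma)) => //.
  have := is_lim_seq_scal_l _ (ln (INR #|Gamma|)) _ is_lim_inv_Rpower_ln.
  by rewrite /= Rmult_0_r.
apply: (@wreath_log_order_clt kf (fun n => <[c n]>%G)) => //.
apply: is_lim_seq_le_le (is_lim_seq_const R0) lim_k => n.
exact: ln_card_cycle_full.
Qed.
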